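(* Consider the policy optimization problem $\max_{\theta\in\mathbb{R}^d}J(\theta)$, $J(\theta)=\mathbb{E}_{\tau\sim p(\cdot|\theta)}[\mathcal{R}(\tau)]$, with trajectory gradient $g(\tau|\theta)$, suppose assumptions (A1)–(A3) of the context hold, let $\epsilon>0$, and run AbaSPIDER-PG with $\eta=\frac1{2L}$, $m=\frac{L\sigma}{\sqrt{Q\epsilon}}$, $B=\frac{\sigma\sqrt Q}{L\sqrt\epsilon}$, $\alpha=48$, $\beta=6$, with $L$ and $Q$ the constants of the context. Then the total STO complexity of AbaSPIDER-PG to achieve $\mathbb{E}\|\nabla J(\theta_\xi)\|^2\le\epsilon$ is $$\underbrace{2KB+\sum_{k=0}^{\lfloor K/m\rfloor}\frac{\alpha\sigma^2}{\frac\beta m\sum_{i=km-m}^{km-1}\|v_i\|^2+\epsilon}}_{\text{complexity of AbaSPIDER-PG}}\ <\ \underbrace{2KB+\sum_{k=0}^{\lfloor K/m\rfloor}\frac{\alpha\sigma^2}{\epsilon}}_{\text{complexity of vanilla SPIDER-PG}}=\mathcal{O}\big(\epsilon^{-3/2}+\epsilon^{-1}\big),$$ where $K$ denotes the total number of iterations.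
   Context: Setting. A discounted MDP with state space $\mathcal{S}$, action space $\mathcal{A}$, transition model $\mathcal{P}(s'|s,a)$, reward $\mathcal{R}(s,a)\in[-R,R]$, discount $\gamma\in[0,1)$, initial state distribution $\rho$, finite horizon $H$; policies $\pi_\theta(\cdot|s)$, $\theta\in\mathbb{R}^d$. $p(\cdot|\theta)$ is the distribution of the trajectory $\tau=(s_0,a_0,\dots,s_{H-1},a_{H-1})$ under $\pi_\theta$ with $s_0\sim\rho$; $\mathcal{R}(\tau)=\sum_{t}\gamma^t\mathcal{R}(s_t,a_t)$ (sum over the time steps of the trajectory). $g(\tau|\theta)$ is a trajectory gradient, for instance REINFORCE, $g=\big(\sum_t\gamma^t\mathcal{R}(s_t,a_t)-b(s_t,a_t)\big)\big(\sum_t\nabla\log\pi_\theta(a_t|s_t)\big)$, or G(PO)MDP, $g=\sum_t(\gamma^t\mathcal{R}(s_t,a_t)-b(s_t,a_t))\sum_{i\le t}\nabla\log\pi_\theta(a_i|s_i)$, with $b$ a bias (baseline) function. $\theta^*=\arg\max_{\theta\in\mathbb{R}^d}J(\theta)$. Assumptions. (A1) $\mathbb{E}_{\tau\sim p(\cdot|\theta)}[g(\tau|\theta)]=\nabla J(\theta)$ for all $\theta$. (A2) There are finite constants $G,C_H,R\ge0$ with $|\nabla_{\theta_i}\log\pi_\theta(a|s)|\le G$, $|\mathcal{R}(s,a)|\le R$, $|\frac{\partial^2}{\partial\theta_i\partial\theta_j}\log\pi_\theta(a|s)|\le C_H$ for all $(s,a)$, $\theta$, $1\le i,j\le d$. (A3)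 There is $\sigma^2<\infty$ with $\mathbb{E}_{\tau\sim p(\cdot|\theta)}\|g(\tau|\theta)-\nabla J(\theta)\|^2\le\sigma^2$ for all $\theta\in\mathbb{R}^d$. Constants. Under (A1)–(A3) it is known from earlier work (Papini et al. 2018; Xu et al. 2019) that there exist constants $L>0$, $L_g$, $\Gamma$, $\alpha_\omega>0$ such that: $\|\nabla J(\theta_1)-\nabla J(\theta_2)\|\le L\|\theta_1-\theta_2\|$; $\|g(\tau|\theta_1)-g(\tau|\theta_2)\|\le L_g\|\theta_1-\theta_2\|$ for all $\tau$; $\|g(\tau|\theta)\|^2\le\Gamma$; and $\mathbb{E}_{\tau\sim p(\cdot|\theta_1)}\big|1-\frac{p(\tau|\theta_2)}{p(\tau|\theta_1)}\big|^2\le\alpha_\omega\|\theta_1-\theta_2\|^2$. Fix such constants and set $Q=2(L_g^2+\Gamma\alpha_\omega)$. Importance weight: $\omega(\tau|\theta_1,\theta_2)=p(\tau|\theta_2)/p(\tau|\theta_1)$. AbaSPIDER-PG. Inputs: $\theta_0\in\mathbb{R}^d$, $\eta,\epsilon,\alpha,\beta>0$, epoch length $m$, mini-batch size $B$. For $k=0,1,\dots,K$, with $n_k=\lfloor k/m\rfloor m$: if $k\equiv0\pmod m$, draw $\tau_1,\dots,\tau_N$ i.i.d. from $p(\cdot|\theta_k)$ with $N=\frac{\alpha\sigma^2}{\frac\beta m\sum_{i=n_k-m}^{n_k-1}\|v_i\|^2+\epsilon}$ (convention $\|v_{-1}\|=\dots=\|v_{-m}\|=0$) and set $v_k=\frac1N\sum_{i=1}^Ng(\tau_i|\theta_k)$;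 otherwise draw $\tau_1,\dots,\tau_B$ i.i.d. from $p(\cdot|\theta_k)$ and set $v_k=\frac1B\sum_{i=1}^B\big(g(\tau_i|\theta_k)-\omega(\tau_i|\theta_k,\theta_{k-1})g(\tau_i|\theta_{k-1})\big)+v_{k-1}$. In both cases $\theta_{k+1}=\theta_k+\eta v_k$. Output: $\theta_\xi$ uniformly at random from $\{\theta_0,\dots,\theta_K\}$. Sizes that are not integers are understood to be rounded. STO complexity: number of trajectory-gradient computations needed to attain the stated accuracy, counted as in the displayed expressions; vanilla SPIDER-PG is the same method with fixed outer batch size $\alpha\sigma^2/\epsilon$. $\mathcal{O}(\cdot)$ hides constants that do not depend on $\epsilon$.
   Formalization: The strict ''<'' fails when all v_i with i < m⌊K/m⌋ vanish (e.g. zero reward with g = 0, or K < m), as both sides are then equal; the formal theorem gives ''≤'' for every outcome and ''<'' whenever some such v_i is nonzero. *)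

(* Defs.v *)
From HB Require Import structures.
From mathcomp Require Import all_boot all_order all_algebra.
From mathcomp Require Import all_classical all_reals all_analysis.
From mathcomp Require Import measurable_realfun.

Set Implicit Arguments.
Unset Strict Implicit.
Unset Printing Implicit Defensive.

Import Order.TTheory GRing.Theory Num.Theory.
Import numFieldNormedType.Exports.

Local Open Scope classical_set_scope.
Local Open Scope ring_scope.

Section kernel_facts.
Context d1 d2 d3 (X : measurableType d1) (Y : measurableType d2)
  (Z : measurableType d3) (R : realType).

(* Compositions of probability kernels, packaged as probability kernels. *)
Section pkcomp.
Variables (l : R.-pker X ~> Y) (k : R.-pker (X * Y) ~> Z).

Definition pkcomp : X -> {measure set Z -> \bar R} := (l \; k)%E.

Let measurable_pkcomp U : measurable U ->
  measurable_fun [set: X] (pkcomp ^~ U).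
Proof. exact: measurable_fun_mkcomp_sfinite. Qed.

HB.instance Definition _ := isKernel.Build _ _ _ _ _ pkcomp measurable_pkcomp.

Let pkcomp_setT x : pkcomp x [set: Z] = 1%E.
Proof.
rewrite /pkcomp/= /kcomp (eq_integral (cst 1%E)); last first.
  by move=> y _; exact: prob_kernel.
by rewrite integral_cst// mul1e; exact: prob_kernel.
Qed.

HB.instance Definition _ := Kernel_isProbability.Build _ _ _ _ _
  pkcomp pkcomp_setT.

End pkcomp.

Section pkpre.
Variables (f : X -> Y) (mf : measurable_fun [set: X] f) (k : R.-pker Y ~> Z).

Definition pkpre of measurable_fun [set: X] f :
  X -> {measure set Z -> \bar R} := fun x => k (f x).

Let measurable_pkpre U : measurable U ->
  measurable_fun [set: X] (pkpre mf ^~ U).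
Proof.
by move=> mU; apply: (measurableT_comp (measurable_kernel k U mU) mf).
Qed.

HB.instance Definition _ := isKernel.Build _ _ _ _ _ (pkpre mf) measurable_pkpre.

Let pkpre_setT x : pkpre mf x [set: Z] = 1%E.
Proof. exact: prob_kernel. Qed.

HB.instance Definition _ := Kernel_isProbability.Build _ _ _ _ _
  (pkpre mf) pkpre_setT.

End pkpre.
End kernel_facts.

Section euclidean.
Context (R : realType) (d : nat).

(* The library norm on 'rV[R]_d is the sup norm; this is the Euclidean one. *)
Definition enorm (x : 'rV[R]_d) : R := Num.sqrt (\sum_(i < d) x 0 i ^+ 2).

Definition partial (f : 'rV[R]_d -> R) (i : 'I_d) (x : 'rV[R]_d) : R :=
  'D_(delta_mx 0 i) f x.

Definition grad (f : 'rV[R]_d -> R) (x : 'rV[R]_d) : 'rV[R]_d :=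
  \row_i partial f i x.

(* R^d carries its Borel sigma-algebra through d.-tuple R. *)
Definition row_of (t : d.-tuple R) : 'rV[R]_d := \row_i tnth t i.

End euclidean.

(* ceil x as a natural number, for x >= 0: sizes are rounded up. *)
Definition nat_ceil (R : realType) (x : R) : nat := `|Num.ceil x|%N.

Record mdp (R : realType) dS dA (S : measurableType dS) (A : measurableType dA)
  := Mdp {
  trans : R.-pker (S * A)%type ~> S;
  reward : S * A -> R;
  measurable_reward : measurable_fun setT reward;
  discount : R;
  discount_range : 0 <= discount < 1;
  init : probability S R;
  horizon : nat }.

(* pdens theta s a is pi_theta(a|s), the density of the policy kernel with
   respect to a reference measure on actions (counting measure for discrete
   actions, Lebesgue measure for continuous ones).  It has to be positive for
   log pi_theta(a|s) to make sense for every (s, a). *)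
Record policy (R : realType) dS dA (S : measurableType dS)
    (A : measurableType dA) (d : nat) := Policy {
  pker : 'rV[R]_d -> R.-pker S ~> A;
  pref : {sigma_finite_measure set A -> \bar R};
  pdens : 'rV[R]_d -> S -> A -> R;
  pdens_gt0 : forall theta s a, 0 < pdens theta s a;
  measurable_pdens : measurable_fun setT
    (fun x : d.-tuple R * (S * A) => pdens (row_of x.1) x.2.1 x.2.2);
  pker_pdens : forall theta s U, measurable U ->
    pker theta s U = (\int[pref]_(a in U) (pdens theta s a)%:E)%E }.

Section trajectories.
Context (R : realType) dS dA (S : measurableType dS) (A : measurableType dA).

Lemma measurable_traj_cons n : measurable_fun setT
  (fun x : ((S * A) * S) * n.-tuple (S * A) => [tuple of x.1.1 :: x.2]).
Proof.
apply: measurable_cons => //.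
exact: (measurableT_comp measurable_fst measurable_fst).
Qed.

(* Law of (s_0, a_0, ..., s_(n-1), a_(n-1)) given s_0: draw a_0 from the
   policy, s_1 from the transition model, then recurse from s_1.  The state
   drawn after the last action is discarded. *)
Fixpoint traj_ker (P : R.-pker (S * A)%type ~> S) (pi : R.-pker S ~> A)
    (n : nat) : R.-pker S ~> n.-tuple (S * A) :=
  match n with
  | 0%N => kdirac (measurable_cst [tuple])
  | n'.+1 =>
      pkcomp pi
        (pkcomp P
          (pkcomp (pkpre (traj_ker P pi n') measurable_snd)
                  (kdirac (@measurable_traj_cons n'))))
  end.

End trajectories.

Section objective.
Context (R : realType) dS dA (S : measurableType dS) (A : measurableType dA)
  (d : nat).
Variables (M : mdp R S A) (pi : policy R S A d).

Definition traj := (horizon M).-tuple (S * A).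

(* p(.|theta) *)
Definition traj_law (theta : 'rV[R]_d) : set traj -> \bar R := fun E =>
  (\int[init M]_s traj_ker (trans M) (pker pi theta) (horizon M) s E)%E.

Section traj_law_probability.
Variable theta : 'rV[R]_d.
Local Notation K := (traj_ker (trans M) (pker pi theta) (horizon M)).

Let traj_law0 : traj_law theta set0 = 0%E.
Proof.
by rewrite /traj_law (eq_integral (cst 0%E)) ?integral0// => s _; exact: measure0.
Qed.

Let traj_law_ge0 E : (0 <= traj_law theta E)%E.
Proof. exact: integral_ge0. Qed.

Let traj_law_sigma_additive : semi_sigma_additive (traj_law theta).
Proof.
move=> U mU tU mUU; rewrite [X in _ --> X](_ : _ =
  \int[init M]_s (\sum_(n <oo) K s (U n)))%E; last first.
  apply: eq_integral => s _.
  by apply/esym/cvg_lim => //; exact/measure_semi_sigma_additive.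
apply/cvg_closeP; split.
  by apply: is_cvg_nneseries => n _ _; exact: integral_ge0.
rewrite closeE// integral_nneseries// => n.
exact: (measurable_kernel K _ (mU n)).
Qed.

HB.instance Definition _ := isMeasure.Build _ _ R (traj_law theta)
  traj_law0 traj_law_ge0 traj_law_sigma_additive.

Let traj_law_setT : traj_law theta setT = 1%E.
Proof.
rewrite /traj_law (eq_integral (cst 1%E)); last first.
  by move=> s _; exact: prob_kernel.
by rewrite integral_cst// mul1e; exact: probability_setT.
Qed.

HB.instance Definition _ := Measure_isProbability.Build _ _ R
  (traj_law theta) traj_law_setT.

End traj_law_probability.

Definition traj_return (tau : traj) : R :=
  \sum_(t < horizon M) discount M ^+ t * reward M (tnth tau t).

Definition J (theta : 'rV[R]_d) : R :=
  fine ('E_(traj_law theta)[traj_return])%E.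

(* Density of p(.|theta) with respect to the trajectory measure obtained by
   replacing the policy by the reference measure on actions.  The factors
   rho(s_0) and P(s_(t+1)|s_t,a_t) belong to that measure: they do not depend
   on theta and cancel in p(tau|theta2) / p(tau|theta1). *)
Definition likelihood (theta : 'rV[R]_d) (tau : traj) : R :=
  \prod_(t < horizon M) pdens pi theta (tnth tau t).1 (tnth tau t).2.

Definition importance_weight (tau : traj) (theta1 theta2 : 'rV[R]_d) : R :=
  likelihood theta2 tau / likelihood theta1 tau.

Variable g : traj -> 'rV[R]_d -> 'rV[R]_d.

Definition measurable_gradient : Prop := forall i : 'I_d,
  measurable_fun setT (fun x : d.-tuple R * traj => g x.2 (row_of x.1) 0 i).

Definition unbiased_gradient : Prop := forall theta,
  differentiable (J : _ -> R^o) theta /\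
  forall i : 'I_d,
    ('E_(traj_law theta)[fun tau => (g tau theta 0 i)%R])%E
      = (grad J theta 0 i)%:E.

Definition logp (s : S) (a : A) (theta : 'rV[R]_d) : R := ln (pdens pi theta s a).

Definition regular_policy_and_reward (G C_H Rmax : R) : Prop :=
  forall s a,
    `|reward M (s, a)| <= Rmax /\
    forall theta (i j : 'I_d),
      [/\ derivable (logp s a : _ -> R^o) theta (delta_mx 0 i),
          `|partial (logp s a) i theta| <= G,
          derivable (partial (logp s a) j : _ -> R^o) theta (delta_mx 0 i)
        & `|partial (partial (logp s a) j) i theta| <= C_H].

Definition bounded_variance (sigma : R) : Prop := forall theta,
  ('E_(traj_law theta)[fun tau => (enorm (g tau theta - grad J theta) ^+ 2)%R]
     <= (sigma ^+ 2)%:E)%E.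

Definition smoothness_constants (L L_g Gam alpha_w : R) : Prop :=
  [/\ forall theta1 theta2,
        enorm (grad J theta1 - grad J theta2) <= L * enorm (theta1 - theta2),
      forall tau theta1 theta2,
        enorm (g tau theta1 - g tau theta2) <= L_g * enorm (theta1 - theta2),
      forall tau theta, enorm (g tau theta) ^+ 2 <= Gam
    & forall theta1 theta2,
        ('E_(traj_law theta1)[fun tau =>
            (`|1 - importance_weight tau theta1 theta2| ^+ 2)%R]
          <= (alpha_w * enorm (theta1 - theta2) ^+ 2)%R%:E)%E].

End objective.

Section complexity.
Context (R : realType) (d : nat).
Variables (alpha beta sigma eps : R) (m B : nat).

(* Unrounded outer batch size at an iteration k that is a multiple of m.  At
   k = 0 the truncated subtraction makes the sum empty, which is the convention
   v_(-1) = ... = v_(-m) = 0. *)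
Definition outer_size (v : nat -> 'rV[R]_d) (k : nat) : R :=
  alpha * sigma ^+ 2 /
    (beta / m%:R * \sum_((k - m)%N <= i < k) enorm (v i) ^+ 2 + eps).

Definition batch_size (v : nat -> 'rV[R]_d) (k : nat) : nat :=
  if (k %% m == 0)%N then nat_ceil (outer_size v k) else B.

Definition aba_complexity (K : nat) (v : nat -> 'rV[R]_d) : R :=
  2 * K%:R * B%:R + \sum_(0 <= k < (K %/ m).+1) outer_size v (k * m).

Definition vanilla_complexity (K : nat) : R :=
  2 * K%:R * B%:R + \sum_(0 <= k < (K %/ m).+1) alpha * sigma ^+ 2 / eps.

End complexity.

Section algorithm.
Context (R : realType) dS dA (S : measurableType dS) (A : measurableType dA)
  (d : nat).
Variables (M : mdp R S A) (pi : policy R S A d)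
  (g : traj M -> 'rV[R]_d -> 'rV[R]_d)
  (theta0 : 'rV[R]_d) (eta eps alpha beta sigma : R) (m B K : nat).
Context dO (O : measurableType dO) (P : probability O R).

(* F k is the information available before iteration k, and tau k i is the
   i-th trajectory drawn at iteration k, of which only those with
   i < batch_size count.  aba_iid says that, conditionally on F k, they are
   i.i.d. with law p(.|theta_k), the (random) batch size being F k-measurable. *)
Record aba_spider_pg (F : nat -> set (set O)) (tau : nat -> nat -> O -> traj M)
    (theta v : nat -> O -> 'rV[R]_d) : Prop := AbaSpiderPG {
  aba_sigma_algebra : forall k, sigma_algebra setT (F k);
  aba_measurable : forall k, F k `<=` measurable;
  aba_filtration : forall k l, (k <= l)%N -> F k `<=` F l;
  aba_adapted : forall k i (U : set (traj M)), (k <= K)%N ->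
    measurable U -> F k.+1 (tau k i @^-1` U);
  aba_iid : forall k n (E : set O) (U : nat -> set (traj M)), (k <= K)%N ->
    F k E -> E `<=` [set w | batch_size alpha beta sigma eps m B (v ^~ w) k = n] ->
    (forall i, measurable (U i)) ->
    P (E `&` [set w | forall i, (i < n)%N -> U i (tau k i w)])
    = (\int[P]_(w in E) \prod_(i < n) traj_law pi (theta k w) (U i))%E;
  aba_init : forall w, theta 0 w = theta0;
  aba_outer : forall k w, (k <= K)%N -> (k %% m = 0)%N ->
    let N := batch_size alpha beta sigma eps m B (v ^~ w) k in
    v k w = N%:R^-1 *: \sum_(i < N) g (tau k i w) (theta k w);
  aba_inner : forall k w, (k < K)%N -> (k.+1 %% m <> 0)%N ->
    v k.+1 w = B%:R^-1 *: \sum_(i < B)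
      (g (tau k.+1 i w) (theta k.+1 w)
       - importance_weight pi (tau k.+1 i w) (theta k.+1 w) (theta k w)
           *: g (tau k.+1 i w) (theta k w)) + v k w;
  aba_update : forall k w, (k <= K)%N -> theta k.+1 w = theta k w + eta *: v k w }.

(* xi is uniform on {0, ..., K} and independent of the run up to theta_K. *)
Definition uniform_output (F : nat -> set (set O)) (xi : O -> 'I_K.+1) : Prop :=
  forall k : 'I_K.+1,
    measurable (xi @^-1` [set k]) /\
    forall E, F K E ->
      P (E `&` xi @^-1` [set k]) = (P E * (K.+1%:R^-1)%:E)%E.

End algorithm.

(* Main.v *)
Require Import Defs.
From HB Require Import structures.
From mathcomp Require Import all_boot all_order all_algebra.
From mathcomp Require Import all_classical all_reals all_analysis.
From mathcomp Require Import measurable_realfun.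
From mathcomp Require Import ring lra zify.

(** The comparison of the two complexities is termwise: the adaptive outer batch
    size has the same numerator as the fixed one, and its denominator exceeds eps
    by a multiple of the squared norms of the estimates of the previous epoch
    (aba_complexity_le, aba_complexity_lt).

    The accuracy claim is the convergence proof of SPIDER.  Write e_k for the
    squared error of v_k as an estimate of grad J at theta_k.  Since grad J is
    L-Lipschitz and eta = 1 / (2L), every run satisfies
      eta/4 |v_k|^2 + eta/2 |grad J(theta_k)|^2
        <= J(theta_(k+1)) - J(theta_k) + eta/2 e_k
    (descent_step).  As J is bounded by the horizon times Rmax, summing over k
    bounds the mean squared gradient once the expected errors are controlled by
    the expected squared norms of the v_k, with a constant below 1/2.

    For the errors, two cases.  At an outer iteration v_k is a mean of N_k samples,
    so that its error is at most sigma^2 / N_k, and N_k is chosen to make this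
    (beta/m (squared norms of the previous epoch) + eps) / alpha (outer_error).
    At an inner iteration the new samples estimate the increment
    grad J(theta_k) - grad J(theta_(k-1)) without bias, their second moment is at
    most Q |theta_k - theta_(k-1)|^2, and the expected error grows by at most
    Q eta^2 / B times E|v_(k-1)|^2 (inner_error).  Summing over all iterations
    (sum_epoch_errors), each |v_i|^2 is charged at most m times by the outer
    steps, for a total of 1/8, and at most m - 1 times by the inner steps, for a
    total of 1/4.  Because only m - 1 enters the second count, rounding m and B
    up costs nothing.

    The probabilistic core is the variance of a mean of samples that are i.i.d.
    given the past F_k.  This property is given on rectangles only;
    disintegration extends it to integrals of arbitrary functions of the past and
    of one new sample.  Adding the samples one at a time to the conditioning,
    every cross term vanishes in the inner integral, at a fixed outcome of the
    past, so that no integrability of the run has to be known beforehand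
    (second_moment_iid_sum).  The random batch size is treated on the events
    where it is constant.

    Both the unbiasedness of the corrected samples and the measurability in theta
    of the trajectory law rest on one fact: the importance weight is the density
    of the law at one parameter with respect to the law at another
    (traj_law_density), because the two laws differ by the policy factors only.

    The number of iterations is 16 L Jmax / eps rounded down, where Jmax bounds
    |J|.  Rounding up would not do: the bound C (eps^(-3/2) + eps^(-1)) tends to 0
    for large eps, where no iteration beyond the initial one may be charged. *)

Set Implicit Arguments.
Unset Strict Implicit.
Unset Printing Implicit Defensive.

Import Order.TTheory GRing.Theory Num.Theory.
Import numFieldNormedType.Exports.

Local Open Scope classical_set_scope.
Local Open Scope ring_scope.

(** * Measures with a density *)

Section densities.
Local Open Scope ereal_scope.
Context d (T : measurableType d) (R : realType).
Implicit Types (f : T -> \bar R) (r : T -> R).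

Import HBNNSimple.

(** Simple functions first, then monotone convergence.  The hypothesis on mu is
    an equation between set functions, so that it can be verified on a coarser
    sigma-algebra or for a law given by a formula. *)
Lemma integral_density (mu nu : {measure set T -> \bar R}) r f :
  measurable_fun setT r -> (forall x, (0 <= r x)%R) ->
  (forall A, measurable A -> mu A = \int[nu]_(x in A) (r x)%:E) ->
  measurable_fun setT f -> (forall x, 0 <= f x) ->
  \int[mu]_x f x = \int[nu]_x (f x * (r x)%:E).
Proof.
move=> mr r0 mur mf f0.
have mrE : measurable_fun setT (EFin \o r) by exact/measurable_EFinP.
pose h := nnsfun_approx measurableT mf.
have fE x : f x = limn (fun n => (h n x)%:E).
  by apply/esym/cvg_lim => //; exact: cvg_nnsfun_approx.
have step n : \int[mu]_x (h n x)%:E = \int[nu]_x ((h n x)%:E * (r x)%:E).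
  under eq_integral do rewrite fimfunE -fsumEFin//.
  rewrite ge0_integral_fsum//; last 2 first.
  - by move=> y; exact/measurable_EFinP/measurable_funM.
  - by move=> y x _; rewrite nnfun_muleindic_ge0.
  transitivity (\sum_(y \in range (h n))
      \int[nu]_x ((y * \1_(h n @^-1` [set y]) x)%:E * (r x)%:E)).
    apply: eq_fsbigr => y /[!inE] -[x0 _ <-].
    have mh : measurable (h n @^-1` [set h n x0]) by [].
    under eq_integral do rewrite EFinM.
    rewrite ge0_integralZl//; last 2 first.
    - exact/measurable_EFinP/measurable_indic.
    - by rewrite lee_fin.
    rewrite integral_indic// setIT mur//.
    under [in RHS]eq_integral do rewrite EFinM -muleA.
    rewrite ge0_integralZl//; last 3 first.
    - by apply: emeasurable_funM => //; exact/measurable_EFinP/measurable_indic.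
    - by move=> x _; rewrite mule_ge0// lee_fin.
    - by rewrite lee_fin.
    congr (_ * _); rewrite integral_mkcond.
    apply: eq_integral => x _; rewrite patchE indicE/=.
    by case: ifPn; rewrite ?mul1e ?mul0e.
  rewrite -ge0_integral_fsum//; last 2 first.
  - move=> y; apply: emeasurable_funM => //.
    by apply/measurable_EFinP; exact: measurable_funM.
  - move=> y x _; apply: mule_ge0; last by rewrite lee_fin.
    by rewrite EFinM nnfun_muleindic_ge0.
  apply: eq_integral => x _.
  rewrite -ge0_mule_fsuml ?fsumEFin -?fimfunE// => y.
  by rewrite EFinM nnfun_muleindic_ge0.
transitivity (limn (fun n => \int[mu]_x (h n x)%:E)).
  rewrite -monotone_convergence//.
  - by apply: eq_integral => x _; exact: fE.
  - by move=> n; exact/measurable_EFinP/measurable_funP.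
  - by move=> n x _; rewrite lee_fin.
  - by move=> x _ a b ab; rewrite lee_fin; exact/lefP/nd_nnsfun_approx.
transitivity (limn (fun n => \int[nu]_x ((h n x)%:E * (r x)%:E))).
  by congr (limn _); apply/funext.
rewrite -monotone_convergence//.
- apply: eq_integral => x _; apply/cvg_lim => //.
  by apply: cvgeZr => //; exact: cvg_nnsfun_approx.
- move=> n; apply: emeasurable_funM => //.
  exact/measurable_EFinP/measurable_funP.
- by move=> n x _; rewrite mule_ge0 ?lee_fin.
- move=> x _ a b ab; rewrite lee_wpmul2r ?lee_fin//.
  exact/lefP/nd_nnsfun_approx.
Qed.

Lemma integral_density_EFin (mu nu : {measure set T -> \bar R}) r (f : T -> R) :
  measurable_fun setT r -> (forall x, (0 <= r x)%R) ->
  (forall A, measurable A -> mu A = \int[nu]_(x in A) (r x)%:E) ->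
  measurable_fun setT f ->
  \int[mu]_x (f x)%:E = \int[nu]_x (r x * f x)%:E.
Proof.
move=> mr r0 mur mf.
have mfE : measurable_fun setT (EFin \o f) by exact/measurable_EFinP.
rewrite [LHS]integralE [RHS]integralE; congr (_ - _).
- rewrite (integral_density mr r0 mur)//; last exact: measurable_funepos.
  apply: eq_integral => x _; rewrite !funeposE /= -!EFin_max -EFinM.
  by rewrite maxr_pMl// mul0r mulrC.
- rewrite (integral_density mr r0 mur)//; last exact: measurable_funeneg.
  apply: eq_integral => x _; rewrite !funenegE /= -!EFin_max -EFinM.
  by rewrite maxr_pMl// mulNr mul0r (mulrC (f x)).
Qed.

Lemma integral_mrestr (mu : {measure set T -> \bar R}) D (mD : measurable D) f B :
  measurable B -> measurable_fun setT f -> (forall x, 0 <= f x) ->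
  \int[mrestr mu mD]_(x in B) f x = \int[mu]_(x in B `&` D) f x.
Proof.
move=> mB mf f0.
rewrite [LHS]integral_mkcond [RHS]integral_mkcond.
rewrite [LHS](@integral_density (mrestr mu mD) mu (\1_D : T -> R))//.
- apply: eq_integral => x _; rewrite !patchE in_setI indicE.
  by case: (x \in B); case: (x \in D); rewrite ?mule1 ?mule0.
- by move=> A mA; rewrite integral_indic//= /mrestr setIC.
- exact/(measurable_restrictT _ mB)/measurable_funTS.
- by apply: erestrict_ge0.
Qed.

End densities.

(** * Change of policy *)

Section euclidean_coordinates.
Context (R : realType) (d : nat).

(** The inverse of row_of, through which the measurability in theta of the data
    is expressed. *)
Definition coords (x : 'rV[R]_d) : d.-tuple R := [tuple x 0 i | i < d].

Lemma coordsK x : row_of (coords x) = x.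
Proof. by apply/rowP => i; rewrite mxE tnth_mktuple. Qed.

Lemma measurable_coords d0 (O : measurableType d0) (f : O -> 'rV[R]_d) :
  (forall i, measurable_fun setT (fun w => f w 0 i)) ->
  measurable_fun setT (coords \o f).
Proof.
move=> mf; apply/measurable_fun_tnthP => i.
by rewrite (_ : _ \o _ = fun w => f w 0 i)//; apply/funext => w/=; rewrite tnth_mktuple.
Qed.

End euclidean_coordinates.
Arguments coords {R d} x.

(** On nonnegative numbers the inverse is the power function of exponent -1. *)
Lemma measurable_fun_inv_ge0 d0 (O : measurableType d0) (R : realType)
    (f : O -> R) : measurable_fun setT f -> (forall w, 0 <= f w) ->
  measurable_fun setT (fun w => (f w)^-1).
Proof.
move=> mf f0.
rewrite (_ : (fun _ => _) = (fun x => x `^ -1) \o f); last first.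
  by apply/funext => w /=; rewrite powR_inv1.
exact: measurableT_comp (measurable_powR _) mf.
Qed.

Section change_of_policy.
Local Open Scope ereal_scope.
Context (R : realType) dS dA (S : measurableType dS) (A : measurableType dA)
  (d : nat) (pi : policy R S A d).

Lemma measurable_pdens_at theta :
  measurable_fun setT (fun x : S * A => pdens pi theta x.1 x.2).
Proof.
pose f := fun x : S * A => (coords theta, x).
rewrite (_ : (fun _ => _) = (fun x : d.-tuple R * (S * A) =>
    pdens pi (row_of x.1) x.2.1 x.2.2) \o f); last first.
  by apply/funext => x /=; rewrite coordsK.
apply: measurableT_comp; first exact: measurable_pdens.
exact: measurable_fun_pair.
Qed.

Let measurable_pdens_action theta s : measurable_fun setT (pdens pi theta s).
Proof. exact: measurableT_comp (measurable_pdens_at theta) (pair1_measurable s). Qed.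

(** Both policies have a density with respect to the same reference measure on
    actions, which cancels. *)
Lemma integral_pker_ratio theta1 theta2 s f :
  measurable_fun setT f -> (forall a, 0 <= f a) ->
  \int[pker pi theta2 s]_a f a =
  \int[pker pi theta1 s]_a
    (f a * (pdens pi theta2 s a / pdens pi theta1 s a)%:E).
Proof.
move=> mf f0.
have p0 th a : (0 <= pdens pi th s a)%R by exact/ltW/pdens_gt0.
have mr : measurable_fun setT
    (fun a => (pdens pi theta2 s a / pdens pi theta1 s a)%R).
  by apply: measurable_funM => //; exact: measurable_fun_inv_ge0.
rewrite (@integral_density _ _ _ _ (pref pi) (pdens pi theta2 s))//; last first.
  by move=> U mU; exact: pker_pdens.
rewrite [RHS](@integral_density _ _ _ _ (pref pi) (pdens pi theta1 s))//.
- apply: eq_integral => a _; rewrite -muleA -EFinM divfK//.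
  by rewrite gt_eqF// pdens_gt0.
- by move=> U mU; exact: pker_pdens.
- by apply: emeasurable_funM => //; exact/measurable_EFinP.
- by move=> a; rewrite mule_ge0// lee_fin divr_ge0.
Qed.

End change_of_policy.

Section integral_traj_ker.
Local Open Scope ereal_scope.
Context (R : realType) dS dA (S : measurableType dS) (A : measurableType dA).
Variables (P : R.-pker (S * A)%type ~> S) (p : R.-pker S ~> A).

Lemma integral_pkcomp d1 d2 d3 (X : measurableType d1) (Y : measurableType d2)
    (Z : measurableType d3) (l : R.-pker X ~> Y) (k : R.-pker (X * Y) ~> Z) x f :
  measurable_fun setT f -> (forall z, 0 <= f z) ->
  \int[pkcomp l k x]_z f z = \int[l x]_y \int[k (x, y)]_z f z.
Proof. by move=> mf f0; exact: integral_kcomp. Qed.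

Lemma integral_traj_kerS n s (f : n.+1.-tuple (S * A) -> \bar R) :
  measurable_fun setT f -> (forall x, 0 <= f x) ->
  \int[traj_ker P p n.+1 s]_x f x =
  \int[p s]_a \int[P (s, a)]_s'
    \int[traj_ker P p n s']_x f [tuple of (s, a) :: x].
Proof.
move=> mf f0 /=.
rewrite integral_pkcomp//; apply: eq_integral => a _.
rewrite integral_pkcomp//; apply: eq_integral => s' _.
rewrite integral_pkcomp//; apply: eq_integral => x _.
by rewrite integral_dirac// diracT mul1e.
Qed.

Lemma measurable_integral_traj_ker n d (X : measurableType d)
    (h : X -> S) (f : X * n.-tuple (S * A) -> \bar R) :
  measurable_fun setT h -> measurable_fun setT f -> (forall x, 0 <= f x) ->
  measurable_fun setT (fun x => \int[traj_ker P p n (h x)]_y f (x, y)).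
Proof.
move=> mh mf f0.
exact: (@measurable_fun_integral_finite_kernel _ _ _ _ _ f
  (pkpre (traj_ker P p n) mh) f0 mf).
Qed.

End integral_traj_ker.

Section change_of_policy_trajectories.
Local Open Scope ereal_scope.
Context (R : realType) dS dA (S : measurableType dS) (A : measurableType dA)
  (d : nat) (P : R.-pker (S * A)%type ~> S) (pi : policy R S A d).

Definition path_likelihood n (theta : 'rV[R]_d) (x : n.-tuple (S * A)) : R :=
  \prod_(t < n) pdens pi theta (tnth x t).1 (tnth x t).2.

Lemma path_likelihood_gt0 n theta (x : n.-tuple (S * A)) :
  (0 < path_likelihood theta x)%R.
Proof. by apply: prodr_gt0 => t _; exact: pdens_gt0. Qed.

Lemma path_likelihood_cons n theta sa (x : n.-tuple (S * A)) :
  path_likelihood theta [tuple of sa :: x] =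
  (pdens pi theta sa.1 sa.2 * path_likelihood theta x)%R.
Proof.
rewrite /path_likelihood big_ord_recl; congr (_ * _)%R.
by apply: eq_bigr => t _; rewrite tnthS.
Qed.

Lemma measurable_path_likelihood n : measurable_fun setT
  (fun x : d.-tuple R * n.-tuple (S * A) => path_likelihood (row_of x.1) x.2).
Proof.
apply: measurable_prod => t _.
pose h (x : d.-tuple R * n.-tuple (S * A)) := (x.1, tnth x.2 t).
rewrite (_ : (fun _ => _) = (fun x : d.-tuple R * (S * A) =>
    pdens pi (row_of x.1) x.2.1 x.2.2) \o h)//.
apply: measurableT_comp; first exact: measurable_pdens.
apply: measurable_fun_pair => //.
exact: measurableT_comp (measurable_tnth t) measurable_snd.
Qed.

Definition path_ratio n (theta1 theta2 : 'rV[R]_d) (x : n.-tuple (S * A)) : R :=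
  (path_likelihood theta2 x / path_likelihood theta1 x)%R.

Lemma path_ratio_ge0 n theta1 theta2 (x : n.-tuple (S * A)) :
  (0 <= path_ratio theta1 theta2 x)%R.
Proof. by rewrite divr_ge0// ltW// path_likelihood_gt0. Qed.

Lemma measurable_path_ratio_comp n d0 (O : measurableType d0)
    (f1 f2 : O -> 'rV[R]_d) (h : O -> n.-tuple (S * A)) :
  measurable_fun setT (coords \o f1) -> measurable_fun setT (coords \o f2) ->
  measurable_fun setT h ->
  measurable_fun setT (fun w => path_ratio (f1 w) (f2 w) (h w)).
Proof.
move=> mf1 mf2 mh.
have ml (f : O -> 'rV[R]_d) : measurable_fun setT (coords \o f) ->
    measurable_fun setT (fun w => path_likelihood (f w) (h w)).
  move=> mf.
  rewrite (_ : (fun _ => _) = (fun x : d.-tuple R * n.-tuple (S * A) =>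
     path_likelihood (row_of x.1) x.2) \o (fun w => (coords (f w), h w))).
    apply: measurableT_comp; first exact: measurable_path_likelihood.
    exact: measurable_fun_pair.
  by apply/funext => w /=; rewrite coordsK.
apply: measurable_funM; first exact: ml.
apply: measurable_fun_inv_ge0; first exact: ml.
by move=> w; rewrite ltW// path_likelihood_gt0.
Qed.

(** Induction on the length: the transition kernel is common to the two laws, so
    that each step exchanges one policy factor. *)
Lemma integral_traj_ker_ratio theta1 theta2 n s (f : n.-tuple (S * A) -> \bar R) :
  measurable_fun setT f -> (forall x, 0 <= f x) ->
  \int[traj_ker P (pker pi theta2) n s]_x f x =
  \int[traj_ker P (pker pi theta1) n s]_x (f x * (path_ratio theta1 theta2 x)%:E).
Proof.
have mr k : measurable_fun setT (@path_ratio k theta1 theta2).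
  by apply: measurable_path_ratio_comp => //; exact: measurable_cst.
have mfr k (f' : k.-tuple (S * A) -> \bar R) : measurable_fun setT f' ->
    measurable_fun setT (fun x => f' x * (path_ratio theta1 theta2 x)%:E).
  move=> mf'; apply: emeasurable_funM => //.
  by apply/measurable_EFinP; exact: mr.
elim: n s f => [|n IHn] s f mf f0.
  by rewrite /= !integral_dirac// ?diracT ?mul1e;
    [rewrite /path_ratio /path_likelihood !big_ord0 divr1 mule1|exact: mfr].
rewrite (integral_traj_kerS P (pker pi theta2))//.
rewrite (integral_traj_kerS P (pker pi theta1)); last 2 first.
- exact: mfr.
- by move=> x; rewrite mule_ge0// lee_fin path_ratio_ge0.
have minner th (f' : n.+1.-tuple (S * A) -> \bar R) :
    measurable_fun setT f' -> (forall x, 0 <= f' x) ->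
    measurable_fun setT (fun y : (S * A) * S =>
      \int[traj_ker P (pker pi th) n y.2]_x f' [tuple of y.1 :: x]).
  move=> mf' f'0.
  apply: (@measurable_integral_traj_ker _ _ _ _ _ P (pker pi th) n _
    ((S * A) * S)%type snd (fun x => f' [tuple of x.1.1 :: x.2])) => //.
  by apply: (measurableT_comp mf'); exact: measurable_traj_cons.
have mouter th s0 : measurable_fun setT (fun a => \int[P (s0, a)]_s'
    \int[traj_ker P (pker pi th) n s']_x f [tuple of (s0, a) :: x]).
  rewrite (_ : (fun _ => _) = (fun sa => \int[P sa]_s'
    \int[traj_ker P (pker pi th) n s']_x f [tuple of sa :: x]) \o pair s0)//.
  apply: measurableT_comp => //.
  apply: (@measurable_fun_integral_finite_kernel _ _ _ _ _ (fun y =>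
    \int[traj_ker P (pker pi th) n y.2]_x f [tuple of y.1 :: x]) P) => //.
    by move=> y; exact: integral_ge0.
  exact: minner.
have mcons sa (f' : n.+1.-tuple (S * A) -> \bar R) : measurable_fun setT f' ->
    measurable_fun setT (fun x : n.-tuple (S * A) => f' [tuple of sa :: x]).
  by move=> mf'; apply: (measurableT_comp mf'); exact: measurable_cons.
rewrite (@integral_pker_ratio _ _ _ _ _ _ _ theta1)//; last first.
- by move=> a; apply: integral_ge0 => s' _; exact: integral_ge0.
apply: eq_integral => a _.
rewrite -ge0_integralZr//; last 3 first.
- apply: (measurableT_comp (minner theta2 f mf f0) (pair1_measurable _)).
- by move=> s' _; exact: integral_ge0.
- by rewrite lee_fin divr_ge0// ltW// pdens_gt0.
apply: eq_integral => s' _.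
rewrite IHn//; last first.
  exact: mcons.
rewrite -ge0_integralZr//; last 3 first.
- by apply: mfr; exact: mcons.
- by move=> x _; rewrite mule_ge0// lee_fin path_ratio_ge0.
- by rewrite lee_fin divr_ge0// ltW// pdens_gt0.
apply: eq_integral => x _.
rewrite -muleA -EFinM; congr (_ * _%:E).
rewrite /path_ratio !path_likelihood_cons/= invfM.
by ring.
Qed.

End change_of_policy_trajectories.

(** * The law of a trajectory *)

Section trajectory_law.
Local Open Scope ereal_scope.
Context (R : realType) dS dA (S : measurableType dS) (A : measurableType dA)
  (d : nat) (M : mdp R S A) (pi : policy R S A d).

(** The law is the composition of the initial distribution, as a constant kernel,
    with the kernel of trajectories. *)
Lemma integral_traj_law theta f :
  measurable_fun setT f -> (forall x, 0 <= f x) ->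
  \int[traj_law pi theta]_x f x =
  \int[init M]_s \int[traj_ker (trans M) (pker pi theta) (horizon M) s]_x f x.
Proof.
move=> mf f0.
pose cinit (u : unit) : pprobability S R := init M.
have mi : measurable_fun setT cinit by exact: measurable_cst.
pose K := traj_ker (trans M) (pker pi theta) (horizon M).
have -> : \int[traj_law pi theta]_x f x =
    \int[pkcomp (kprobability mi) (pkpre K measurable_snd) tt]_x f x.
  by apply: eq_measure_integral => U mU _.
by rewrite integral_pkcomp.
Qed.

Lemma integral_traj_law_ratio theta1 theta2 (f : traj M -> \bar R) :
  measurable_fun setT f -> (forall x, 0 <= f x) ->
  \int[traj_law pi theta2]_x f x =
  \int[traj_law pi theta1]_x (f x * (importance_weight pi x theta1 theta2)%:E).
Proof.
move=> mf f0.
have mr : measurable_fun setT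
    (fun x : traj M => importance_weight pi x theta1 theta2).
  by apply: (measurable_path_ratio_comp pi) => //; exact: measurable_cst.
have mfr : measurable_fun setT (fun x : traj M =>
    f x * (importance_weight pi x theta1 theta2)%:E).
  by apply: emeasurable_funM => //; apply/measurable_EFinP.
have fr0 (x : traj M) : 0 <= f x * (importance_weight pi x theta1 theta2)%:E.
  by rewrite mule_ge0// lee_fin path_ratio_ge0.
have E2 := @integral_traj_law theta2 f mf f0.
have E1 := @integral_traj_law theta1 _ mfr fr0.
apply: (etrans E2); apply: (etrans _ (esym E1)).
by apply: eq_integral => s _; exact: integral_traj_ker_ratio.
Qed.

Lemma importance_weight_ge0 theta1 theta2 (x : traj M) :
  (0 <= importance_weight pi x theta1 theta2)%R.
Proof. exact: path_ratio_ge0. Qed.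

Lemma measurable_importance_weight d0 (O : measurableType d0)
    (f1 f2 : O -> 'rV[R]_d) (h : O -> traj M) :
  measurable_fun setT (coords \o f1) -> measurable_fun setT (coords \o f2) ->
  measurable_fun setT h ->
  measurable_fun setT (fun w => importance_weight pi (h w) (f1 w) (f2 w)).
Proof. exact: measurable_path_ratio_comp. Qed.

Lemma traj_law_density theta1 theta2 U : measurable U ->
  traj_law pi theta2 U =
  \int[traj_law pi theta1]_(x in U) (importance_weight pi (x : traj M) theta1 theta2)%:E.
Proof.
move=> mU.
have m1 : measurable_fun setT (fun x : traj M => (\1_U x)%:E : \bar R).
  exact/measurable_EFinP/measurable_indic.
have E := @integral_traj_law_ratio theta1 theta2 _ m1 _.
rewrite integral_indic// setIT in E; rewrite E; last by move=> x; rewrite lee_fin.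
rewrite [RHS]integral_mkcond; apply: eq_integral => x _.
by rewrite patchE indicE; case: ifPn => _; rewrite ?mul1e ?mul0e.
Qed.

End trajectory_law.

(** * Disintegration of a joint law *)

Section density_measure.
Local Open Scope ereal_scope.
Context d (T : measurableType d) (R : realType)
  (nu : {measure set T -> \bar R}) (r : T -> R).
Hypothesis mr : measurable_fun setT r.
Hypothesis r0 : forall x, (0 <= r x)%R.

(** The hypotheses are arguments so that a canonical measure can be attached. *)
Definition mdensity & measurable_fun setT r & (forall x, (0 <= r x)%R) :
  set T -> \bar R := fun A => \int[nu]_(x in A) (r x)%:E.

Let mdensity0 : mdensity mr r0 set0 = 0.
Proof. exact: integral_set0. Qed.

Let mdensity_ge0 A : 0 <= mdensity mr r0 A.
Proof. by apply: integral_ge0 => x _; rewrite lee_fin. Qed.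

Let mdensity_sigma_additive : semi_sigma_additive (mdensity mr r0).
Proof.
move=> F mF tF mUF; rewrite /mdensity ge0_integral_bigcup//.
- by apply: is_cvg_nneseries => n _ _; apply: integral_ge0 => x _; rewrite lee_fin.
- exact/measurable_EFinP/measurable_funTS.
- by move=> x _; rewrite lee_fin.
Qed.

HB.instance Definition _ := isMeasure.Build _ _ R (mdensity mr r0)
  mdensity0 mdensity_ge0 mdensity_sigma_additive.

End density_measure.

Section disintegration.
Local Open Scope ereal_scope.
Context dO dY dT (O : measurableType dO) (Y : measurableType dY)
  (T : measurableType dT) (R : realType).
Variables (mu : {finite_measure set O -> \bar R}) (phi : O -> Y) (tau : O -> T)
  (nu : {sigma_finite_measure set T -> \bar R}) (r : Y * T -> R)
  (G : set (set Y)).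
Hypotheses (mphi : measurable_fun setT phi) (mtau : measurable_fun setT tau)
  (mr : measurable_fun setT r) (r0 : forall x, (0 <= r x)%R)
  (genG : @measurable _ Y = <<s G >>) (GI : setI_closed G) (GT : G setT)
  (rectangles : forall D U, G D -> measurable U ->
    mu ((phi @^-1` D) `&` (tau @^-1` U)) =
    \int[mu]_(w in phi @^-1` D) \int[nu]_(t in U) (r (phi w, t))%:E).

Let mphiT : measurable_fun setT (fun x : O * T => (phi x.1, x.2)).
Proof. by apply: measurable_fun_pair => //; exact: measurableT_comp. Qed.

Let mrphi : measurable_fun setT (fun x : O * T => r (phi x.1, x.2)).
Proof. exact: measurableT_comp mr mphiT. Qed.

Let rphi0 (x : O * T) : (0 <= r (phi x.1, x.2))%R.
Proof. by []. Qed.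

Let mphitau : measurable_fun setT (fun w => (phi w, tau w)).
Proof. exact: measurable_fun_pair. Qed.

Let rect := [set D `*` U | D in G & U in @measurable _ T].

Let rect_generates : @measurable _ (Y * T)%type = <<s rect >>.
Proof.
have mfst : measurable_fun setT (fst : g_sigma_algebraType rect -> Y).
  apply: (measurability _ genG) => Z /= [D GD <-].
  rewrite setTI; apply: sub_sigma_algebra; exists D => //; exists setT => //.
  by apply/seteqP; split => x; rewrite /setX /preimage /=; tauto.
have msnd : measurable_fun setT (snd : g_sigma_algebraType rect -> T).
  move=> _ U mU; rewrite setTI; apply: sub_sigma_algebra.
  exists setT => //; exists U => //.
  by apply/seteqP; split => x; rewrite /setX /preimage /=; tauto.
rewrite measurable_prod_measurableType; apply/seteqP; split.
  apply: smallest_sub; first exact: smallest_sigma_algebra.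
  move=> _ [D mD [U mU <-]].
  have /= h1 := mfst measurableT D mD; have /= h2 := msnd measurableT U mU.
  rewrite !setTI in h1 h2.
  exact: (@measurableI _ (g_sigma_algebraType rect) _ _ h1 h2).
apply: sub_sigma_algebra2 => _ [D GD [U mU <-]]; exists D.
  by rewrite genG; exact: sub_sigma_algebra.
by exists U.
Qed.

Let lawE A : measurable A -> pushforward mu (fun w => (phi w, tau w)) A =
  pushforward (mdensity (mu \x nu) mrphi rphi0)
    (fun x : O * T => (phi x.1, x.2)) A.
Proof.
have GTT : rect setT.
  by exists setT => //; exists setT => //; rewrite setXTT.
apply: (measure_unique rect (fun=> setT)) => //.
- move=> _ _ [D1 GD1 [U1 mU1 <-]] [D2 GD2 [U2 mU2 <-]].
  exists (D1 `&` D2); first exact: GI.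
  by exists (U1 `&` U2); [exact: measurableI|rewrite setXI].
- by rewrite bigcup_const//; exists 0%N.
- move=> _ [D GD [U mU <-]].
  have mD : measurable D by rewrite genG; exact: sub_sigma_algebra.
  rewrite /pushforward /mdensity/=.
  transitivity (mu ((phi @^-1` D) `&` (tau @^-1` U))) => //.
  rewrite rectangles// integral_mkcond [RHS]integral_mkcond.
  set B := _ @^-1` (D `*` U).
  have mB : measurable B.
    by rewrite -[B]setTI; apply: mphiT => //; exact: measurableX.
  set h := (X in _ = \int[_]_x X x).
  have mh : measurable_fun setT h.
    apply/(measurable_restrictT _ mB)/measurable_funTS.
    exact/measurable_EFinP.
  have h0 x : 0 <= h x by apply: erestrict_ge0 => y _; rewrite lee_fin.
  rewrite (fubini_tonelli1 h)//; apply: eq_integral => w _.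
  rewrite patchE; case: ifPn => wD.
    rewrite integral_mkcond; apply: eq_integral => t _.
    rewrite /h !patchE; suff -> : ((w, t) \in B) = (t \in U) by [].
    rewrite inE in wD; apply/idP/idP; rewrite !inE.
      by case.
    by move=> Ut; split.
  rewrite /fubini_F integral0_eq// => t _.
  by rewrite /h patchE memNset// => -[/= Dw _]; move/negP: wD; apply; rewrite inE.
- move=> k; change (mu setT < +oo).
  by rewrite -ge0_fin_numE ?fin_num_measure.
Qed.

(** Both sides are integrals of f against measures on Y * T.  These measures agree
    on the rectangles with base in the pi-system G, hence everywhere. *)
Lemma disintegration f : measurable_fun setT f -> (forall x, 0 <= f x) ->
  \int[mu]_w f (phi w, tau w) =
  \int[mu]_w \int[nu]_t (f (phi w, t) * (r (phi w, t))%:E).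
Proof.
move=> mf f0.
rewrite -[LHS](@ge0_integral_pushforward _ _ _ _ _ _ mphitau mu setT f)//.
rewrite (eq_measure_integral (pushforward
  (mdensity (mu \x nu) mrphi rphi0) (fun x : O * T => (phi x.1, x.2)))); last first.
  by move=> A mA _; exact: lawE.
rewrite ge0_integral_pushforward// preimage_setT.
rewrite (@integral_density _ _ _ _ (mu \x nu) (fun x => r (phi x.1, x.2)))//.
- rewrite fubini_tonelli1//; last first.
    by move=> x; apply: mule_ge0; [exact: f0|rewrite lee_fin; exact: r0].
  apply: emeasurable_funM; last exact/measurable_EFinP.
  exact: measurableT_comp.
- exact: measurableT_comp.
- by move=> x; exact: f0.
Qed.

End disintegration.

(** * Sub-sigma-algebras and centered variables *)

Lemma measurable_sub_sigma_algebra d (O : measurableType d) (F : set (set O)) :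
  F `<=` measurable ->
  @measurable_fun _ _ O (g_sigma_algebraType F) setT id.
Proof.
move=> Fm; apply: (@measurability _ _ O (g_sigma_algebraType F) setT id F) => //.
by move=> _ [A FA <-]; rewrite setTI; exact: Fm.
Qed.

Section restriction_to_sub_sigma_algebra.
Local Open Scope ereal_scope.
Context d (O : measurableType d) (R : realType) (F : set (set O))
  (mu : {measure set O -> \bar R}).
Hypothesis Fm : F `<=` measurable.
Local Notation FO := (g_sigma_algebraType F).

(** The measure mu on a coarser sigma-algebra: the measures compared below are
    only known to agree there. *)
Definition sub_measure & F `<=` measurable : set FO -> \bar R := mu.

Let measurable_sub (A : set FO) : measurable A -> measurable (A : set O).
Proof.
move=> mA; rewrite -[X in measurable X]setTI.
exact: (measurable_sub_sigma_algebra Fm measurableT mA).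
Qed.

Let sub_measure0 : sub_measure Fm set0 = 0.
Proof. exact: measure0. Qed.

Let sub_measure_ge0 A : 0 <= sub_measure Fm A.
Proof. exact: measure_ge0. Qed.

Let sub_measure_sigma_additive : semi_sigma_additive (sub_measure Fm).
Proof.
move=> A mA tA mUA; apply: (@measure_semi_sigma_additive _ _ _ mu A) => //.
- by move=> n; exact: measurable_sub.
- exact: measurable_sub.
Qed.

HB.instance Definition _ := isMeasure.Build _ _ R (sub_measure Fm)
  sub_measure0 sub_measure_ge0 sub_measure_sigma_additive.

Lemma integral_sub_measure A (f : FO -> \bar R) :
  measurable A -> measurable_fun setT f -> (forall w, 0 <= f w) ->
  \int[sub_measure Fm]_(w in A) f w = \int[mu]_(w in A) f w.
Proof.
move=> mA mf f0.
have mid := measurable_sub_sigma_algebra Fm.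
by rewrite -[RHS](ge0_integral_pushforward mid)//; exact: measurable_funTS.
Qed.

End restriction_to_sub_sigma_algebra.

Section centered_shift.
Local Open Scope ereal_scope.
Context d (T : measurableType d) (R : realType) (p : probability T R).

(** A probability is finite and |h| <= 1 + h^2. *)
Lemma integrable_square_integrable (h : T -> R) : measurable_fun setT h ->
  \int[p]_t (h t ^+ 2)%:E < +oo -> p.-integrable setT (EFin \o h).
Proof.
move=> mh hfin.
apply: (@le_integrable _ _ _ _ _ measurableT _ (fun t => (1 + h t ^+ 2)%:E)) => //.
- exact/measurable_EFinP.
- move=> t _ /=; rewrite lee_fin [leRHS]ger0_norm ?addr_ge0 ?sqr_ge0//.
  rewrite -[(h t ^+ 2)%R]real_normK ?num_real//.
  by have := sqr_ge0 (`|h t| - 1)%R; have := sqr_ge0 `|h t|; nra.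
rewrite (_ : (fun _ => _) = cst 1%:E \+ (fun t => (h t ^+ 2)%:E))//.
apply: integrableD => //.
  exact: finite_measure_integrable_cst.
apply/integrableP; split; first by apply/measurable_EFinP; exact: measurable_funX.
rewrite (eq_integral (fun t => (h t ^+ 2)%:E))// => t _.
  by rewrite /= ger0_norm ?sqr_ge0.
Qed.

(** The cross term 2 x a h has integral zero. *)
Lemma integral_centered_shift (h : T -> R) (x a : R) : measurable_fun setT h ->
  \int[p]_t (h t ^+ 2)%:E < +oo -> \int[p]_t (h t)%:E = 0 ->
  \int[p]_t ((x + a * h t) ^+ 2)%:E =
  (x ^+ 2)%:E + (a ^+ 2)%:E * \int[p]_t (h t ^+ 2)%:E.
Proof.
move=> mh hfin h0.
have ih := integrable_square_integrable mh hfin.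
have ih2 : p.-integrable setT (fun t => (h t ^+ 2)%:E).
  apply/integrableP; split; first by apply/measurable_EFinP; exact: measurable_funX.
  rewrite (eq_integral (fun t => (h t ^+ 2)%:E))// => t _.
  by rewrite /= ger0_norm ?sqr_ge0.
transitivity (\int[p]_t ((x ^+ 2)%:E +
    ((2 * x * a)%:E * (h t)%:E + (a ^+ 2)%:E * (h t ^+ 2)%:E))).
  by apply: eq_integral => t _; rewrite -!EFinM -!EFinD; congr EFin; ring.
have ic : p.-integrable setT (cst (x ^+ 2)%:E).
  exact: finite_measure_integrable_cst.
have i1 := integrableZl measurableT (2 * x * a) ih.
have i2 := integrableZl measurableT (a ^+ 2) ih2.
rewrite integralD//; last exact: integrableD.
rewrite integral_cst// [X in _ * X]probability_setT mule1; congr (_ + _).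
rewrite integralD// !integralZl//.
by rewrite h0 mule0 add0e.
Qed.

End centered_shift.

(** * Averages of conditionally i.i.d. samples *)

Section iid_sampling.
Local Open Scope ereal_scope.
Context dO (O : measurableType dO) dT (T : measurableType dT) (R : realType)
  (P : probability O R).
Variables (F : set (set O)) (tau : nat -> O -> T) (nu : probability T R)
  (p : O -> probability T R) (r : g_sigma_algebraType F * T -> R)
  (D0 : set O) (n : nat).
Hypotheses (sF : sigma_algebra setT F) (Fm : F `<=` measurable)
  (mtau : forall i, measurable_fun setT (tau i))
  (mr : measurable_fun setT r) (r0 : forall x, (0 <= r x)%R)
  (pE : forall w U, measurable U -> p w U = \int[nu]_(t in U) (r (w, t))%:E)
  (FD0 : F D0)
  (iid : forall E (U : nat -> set T), F E -> E `<=` D0 ->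
    (forall i, measurable (U i)) ->
    P (E `&` [set w | forall i, (i < n)%N -> U i (tau i w)]) =
    \int[P]_(w in E) \prod_(i < n) p w (U i)).

Local Notation FO := (g_sigma_algebraType F).

Let FI A B : F A -> F B -> F (A `&` B).
Proof.
rewrite -(sigma_algebra_id sF) => FA FB.
exact: (@measurableI _ FO).
Qed.

Let measurable_FO A : @measurable _ FO A -> F A.
Proof. by rewrite /measurable/= sigma_algebra_id. Qed.

Let mid : @measurable_fun _ _ O FO setT id.
Proof. exact: measurable_sub_sigma_algebra. Qed.

(** The density turns the kernel into a fixed measure, to which Tonelli applies. *)
Lemma measurable_integral_kernel_density (f : FO * T -> \bar R) :
  measurable_fun setT f -> (forall x, 0 <= f x) ->
  measurable_fun setT (fun w : FO => \int[p w]_t f (w, t)).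
Proof.
move=> mf f0.
rewrite (_ : (fun _ => _) = fubini_F nu (fun x => f x * (r x)%:E)).
  apply: measurable_fun_fubini_tonelli_F.
    by apply: emeasurable_funM => //; exact/measurable_EFinP.
  by move=> x; rewrite mule_ge0 ?lee_fin.
apply/funext => w; rewrite /fubini_F.
rewrite (@integral_density _ _ _ (p w) nu (fun t => r (w, t)))//.
- exact: measurableT_comp.
- exact: pE.
- exact: measurableT_comp.
Qed.

Let measurable_p U : measurable U -> measurable_fun setT (fun w : FO => p w U).
Proof.
move=> mU.
rewrite (_ : (fun _ => _) = (fun w : FO => \int[p w]_t (\1_U t)%:E)).
  apply: (@measurable_integral_kernel_density (fun x => (\1_U x.2)%:E)).
    apply/measurable_EFinP.
    exact: (measurableT_comp (measurable_indic mU) measurable_snd).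
  by move=> x; rewrite lee_fin.
by apply/funext => w; rewrite integral_indic// setIT.
Qed.

Definition sampled j (U : nat -> set T) : set O :=
  [set w | forall i, (i < j)%N -> U i (tau i w)].

(** A pi-system generating what is known from F and the first j samples. *)
Definition history j : set (set O) :=
  [set E `&` sampled j U | E in F & U in [set U | forall i, measurable (U i)]].

Local Notation GO j := (g_sigma_algebraType (history j)).

Let FT : F setT.
Proof. by apply: measurable_FO; exact: (@measurableT _ FO). Qed.

Let F_history j : F `<=` history j.
Proof.
move=> E FE; exists E => //; exists (fun=> setT) => //.
by apply/seteqP; split => w; rewrite /sampled /=; tauto.
Qed.

Let history_setI j : setI_closed (history j).
Proof.
move=> _ _ [E1 FE1 [U1 mU1 <-]] [E2 FE2 [U2 mU2 <-]].
exists (E1 `&` E2); first exact: FI.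
exists (fun i => U1 i `&` U2 i); first by move=> i; exact: measurableI.
apply/seteqP; split => w; rewrite /sampled/=.
  by move=> [[? ?] h]; split; split => // i ij; have [] := h i ij.
by move=> [[? h1] [? h2]]; split => // i ij; split; [exact: h1|exact: h2].
Qed.

Let measurable_sampled j U : (forall i, measurable (U i)) ->
  measurable (sampled j U).
Proof.
move=> mU.
rewrite (_ : sampled j U = \bigcap_(i in `I_j) (tau i @^-1` U i))//.
apply: fin_bigcap_measurable => // i _.
by rewrite -[X in measurable X]setTI; exact: mtau.
Qed.

Let history_measurable j : history j `<=` measurable.
Proof.
move=> _ [E FE [U mU <-]].
by apply: measurableI; [exact: Fm|exact: measurable_sampled].
Qed.

Let mid_history j : @measurable_fun _ _ O (GO j) setT id.
Proof. exact: measurable_sub_sigma_algebra. Qed.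

Let history_id j : @measurable_fun _ _ (GO j) FO setT id.
Proof.
apply: (@measurability _ _ (GO j) FO setT id F) => // _ [E FE <-].
by rewrite setTI; apply: sub_sigma_algebra; exact: F_history.
Qed.

Let history_pair_id j :
  @measurable_fun _ _ (GO j * T)%type (FO * T)%type setT id.
Proof.
apply/measurable_fun_pairP; split; last exact: measurable_snd.
exact: (measurableT_comp (@history_id j) measurable_fst).
Qed.

Let history_sample i j : (i < j)%N ->
  @measurable_fun _ _ (GO j) T setT (tau i).
Proof.
move=> ij _ U mU; rewrite setTI; apply: sub_sigma_algebra.
exists setT; first exact: FT.
exists (fun l => if l == i then U else setT).
  by move=> l; case: ifP.
apply/seteqP; split => w; rewrite /sampled/=.
  by move=> [_ /(_ i ij)]; rewrite eqxx.
by move=> Uw; split=> // l lj; case: eqP => // ->.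
Qed.

Let law_sampled j E U : (j <= n)%N -> F E -> E `<=` D0 ->
  (forall i, measurable (U i)) ->
  P (E `&` sampled j U) = \int[P]_(w in E) \prod_(i < j) p w (U i).
Proof.
move=> jn FE ED mU.
pose U' i := if (i < j)%N then U i else setT.
have -> : E `&` sampled j U =
    E `&` [set w | forall i, (i < n)%N -> U' i (tau i w)].
  congr (_ `&` _); apply/seteqP; split => w; rewrite /sampled /U' /=.
    by move=> h i _; case: ifP => // ij; exact: h.
  by move=> h i ij; have := h i (leq_trans ij jn); rewrite ij.
rewrite iid//; last by move=> i; rewrite /U'; case: ifP.
apply: eq_integral => w _.
rewrite (big_ord_widen n (fun i => p w (U i)) jn) [RHS]big_mkcond.
apply: eq_bigr => i _; rewrite /U'; case: ifP => // _.
exact: probability_setT.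
Qed.

(** Integrating out the first j samples: p w V depends on F only, and within D0
    the restriction of P to the event sampled j U has, on F, the density given by
    the product (law_sampled). *)
Let integral_history j E U V : (j <= n)%N -> F E -> measurable V ->
  (forall i, measurable (U i)) ->
  \int[P]_(w in (E `&` sampled j U) `&` D0) p w V =
  \int[P]_(w in E `&` D0) ((\prod_(i < j) p w (U i)) * p w V).
Proof.
move=> jn FE mV mU.
have mED : measurable (E `&` D0) by apply: Fm; exact: FI.
have mB : measurable ((E `&` D0) `&` sampled j U).
  by apply: measurableI => //; exact: measurable_sampled.
have mpO f : measurable_fun setT (f : FO -> \bar R) ->
    measurable_fun setT (f : O -> \bar R).
  by move=> mf; exact: (measurableT_comp mf mid).
pose q (w : FO) : R := (\prod_(i < j) fine (p w (U i)))%R.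
have qE w : (q w)%:E = \prod_(i < j) p w (U i).
  by rewrite /q -prodEFin; apply: eq_bigr => i _; rewrite fineK// fin_num_measure.
have mq : measurable_fun setT q.
  apply: measurable_prod => i _.
  by apply: (measurableT_comp (fine_measurable measurableT)); exact: measurable_p.
have q0 w : (0 <= q w)%R by apply: prodr_ge0 => i _; rewrite fine_ge0.
have mqE : measurable_fun setT (EFin \o q) by exact/measurable_EFinP.
have push (B : set O) (mB' : measurable B) (A : set FO) (f : FO -> \bar R) :
    measurable A -> measurable_fun setT f -> (forall w, 0 <= f w) ->
    \int[sub_measure (mrestr P mB') Fm]_(w in A) f w =
    \int[P]_(w in A `&` B) f w.
  move=> mA mf f0; rewrite integral_sub_measure// integral_mrestr//.
  - by apply: Fm; exact: measurable_FO.
  - exact: mpO.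
have dens A : measurable A -> sub_measure (mrestr P mB) Fm A =
    \int[sub_measure (mrestr P mED) Fm]_(w in A) (q w)%:E.
  move=> mA; have FA := measurable_FO mA.
  rewrite push//.
  transitivity (P (A `&` ((E `&` D0) `&` sampled j U))) => //.
  rewrite setIA law_sampled//.
  - by apply: eq_integral => w _; rewrite qE.
  - by apply: FI => //; exact: FI.
  - by move=> w [_ []].
have := integral_density mq q0 dens (measurable_p mV)
  (fun w => measure_ge0 (p w) V).
rewrite !push//; last 3 first.
- by apply: emeasurable_funM => //; exact: measurable_p.
- by move=> w; rewrite mule_ge0// lee_fin.
- exact: measurable_p.
rewrite !setTI setIAC => ->.
by apply: eq_integral => w _; rewrite muleC qE.
Qed.

(** Disintegration along the history of the earlier samples, given which the next
    one still has law p w. *)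
Lemma integral_sample j (f : GO j * T -> \bar R) : (j < n)%N ->
  measurable_fun setT f -> (forall x, 0 <= f x) ->
  \int[P]_(w in D0) f (w, tau j w) = \int[P]_(w in D0) \int[p w]_t f (w, t).
Proof.
move=> jn mf f0.
have mD0 := Fm FD0.
pose r' (x : GO j * T) : R := r x.
have mr' : measurable_fun setT r'.
  exact: (measurableT_comp mr (@history_pair_id j)).
have r'0 x : (0 <= r' x)%R by exact: r0.
have mfr : measurable_fun setT (fun x => f x * (r' x)%:E).
  by apply: emeasurable_funM => //; exact/measurable_EFinP.
have pint (f' : T -> \bar R) w : measurable_fun setT f' -> (forall x, 0 <= f' x) ->
    \int[p w]_t f' t = \int[nu]_t (f' t * (r (w, t))%:E).
  move=> mf' f'0; apply: (@integral_density _ _ _ (p w) nu (fun t => r (w, t))) => //.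
  - exact: (measurableT_comp mr (pair1_measurable (w : FO))).
  - exact: pE.
have rect D V : history j D -> measurable V ->
    mrestr P mD0 ((id @^-1` D) `&` (tau j @^-1` V)) =
    \int[mrestr P mD0]_(w in id @^-1` D) \int[nu]_(t in V) (r' (w, t))%:E.
  move=> [E FE [U mU <-]] mV.
  have mB : measurable (E `&` sampled j U).
    by apply: measurableI; [exact: Fm|exact: measurable_sampled].
  have -> : mrestr P mD0 (id @^-1` (E `&` sampled j U) `&` tau j @^-1` V) =
      \int[P]_(w in (E `&` sampled j U) `&` D0) p w V.
    pose U' i := if i == j then V else U i.
    have -> : mrestr P mD0 (id @^-1` (E `&` sampled j U) `&` tau j @^-1` V) =
        P ((E `&` D0) `&` sampled j.+1 U').
      congr (P _); apply/seteqP; split => w; rewrite /sampled /U'/=.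
        move=> [[[Ew sw] Vw] Dw]; split => // i; rewrite ltnS leq_eqVlt.
        by case: eqP => [->//|_ /= ij]; exact: sw.
      move=> [[Ew Dw] sw]; do !split => //; last first.
        by have := sw j (leqnn _); rewrite eqxx.
      by move=> i ij; have := sw i (ltnW ij); rewrite ltn_eqF.
    rewrite law_sampled//; last 2 first.
    - exact: FI.
    - by move=> i; rewrite /U'; case: ifP.
    rewrite integral_history ?(ltnW jn)//.
    apply: eq_integral => w _; rewrite big_ord_recr/= /U' eqxx; congr (_ * _).
    by apply: eq_bigr => i _; rewrite ltn_eqF.
  rewrite preimage_id integral_mrestr//.
  - by apply: eq_integral => w _; rewrite pE.
  - rewrite (_ : (fun _ => _) = (fun w => p w V)); last first.
      by apply/funext => w; rewrite pE.
    exact: (measurableT_comp (measurable_p mV) mid).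
  - by move=> w; apply: integral_ge0 => t _; rewrite lee_fin.
have := @disintegration _ _ _ O (GO j) T R (mrestr P mD0) id (tau j) nu r'
  (history j) (@mid_history j) (mtau j) mr' r'0 erefl (@history_setI j)
  (@F_history j _ FT) rect f mf f0.
rewrite !integral_mrestr//.
- rewrite !setTI => ->; apply: eq_integral => w _; rewrite pint//.
  exact: (measurableT_comp mf (pair1_measurable (w : GO j))).
- apply: (@measurableT_comp _ _ _ _ _ _ (fubini_F nu (fun x => f x * (r' x)%:E))) => //.
  apply: measurable_fun_fubini_tonelli_F => // x.
  by rewrite mule_ge0 ?lee_fin.
- by move=> w; apply: integral_ge0 => t _; rewrite mule_ge0 ?lee_fin.
- apply: (measurableT_comp mf); apply/measurable_fun_pairP; split => //.
  exact: mtau.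
Qed.

(** Induction on the number of samples: at a fixed history the new sample is
    centered, hence adds a^2 times its second moment and no cross term. *)
Lemma second_moment_iid_sum (c : FO -> R) (h : FO * T -> R) (a : R) j :
  measurable_fun setT c -> measurable_fun setT h ->
  (forall w, \int[p w]_t (h (w, t) ^+ 2)%:E < +oo) ->
  (forall w, \int[p w]_t (h (w, t))%:E = 0) -> (j <= n)%N ->
  \int[P]_(w in D0) ((c w + a * \sum_(i < j) h (w, tau i w)) ^+ 2)%:E =
  \int[P]_(w in D0) (c w ^+ 2)%:E + (j%:R * a ^+ 2)%:E *
    \int[P]_(w in D0) \int[p w]_t (h (w, t) ^+ 2)%:E.
Proof.
move=> mc mh hfin h0.
have mD0 := Fm FD0.
have mh2 : measurable_fun setT (fun w : O => \int[p w]_t (h (w, t) ^+ 2)%:E).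
  have h2F := @measurable_integral_kernel_density (fun x => (h x ^+ 2)%:E).
  apply: (measurableT_comp (h2F _ _) mid).
    by apply/measurable_EFinP; exact: measurable_funX.
  by move=> x; rewrite lee_fin sqr_ge0.
have h20 w : 0 <= \int[p w]_t (h (w, t) ^+ 2)%:E.
  by apply: integral_ge0 => t _; rewrite lee_fin sqr_ge0.
have mpartial l : measurable_fun setT
    (fun w : GO l => (c w + a * \sum_(i < l) h (w, tau i w))%R).
  apply: measurable_funD; first exact: (measurableT_comp mc (@history_id l)).
  apply: measurable_funM => //; apply: measurable_sum => i.
  exact: (measurableT_comp mh
    (measurable_fun_pair (@history_id l) (history_sample (ltn_ord i)))).
elim: j => [_|j IHj jn].
  rewrite mul0r mul0e adde0; apply: eq_integral => w _.
  by rewrite big_ord0 mulr0 addr0.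
pose s (w : GO j) : R := (c w + a * \sum_(i < j) h (w, tau i w))%R.
pose f (x : GO j * T) : \bar R := ((s x.1 + a * h x) ^+ 2)%:E.
have mf : measurable_fun setT f.
  apply/measurable_EFinP; apply: measurable_funX; apply: measurable_funD.
    exact: (measurableT_comp (mpartial j) measurable_fst).
  apply: measurable_funM => //.
  exact: (measurableT_comp mh (@history_pair_id j)).
transitivity (\int[P]_(w in D0) f (w, tau j w)).
  apply: eq_integral => w _; rewrite /f /s big_ord_recr/= mulrDr addrA.
  by [].
rewrite (integral_sample jn)//; last by move=> x; rewrite lee_fin sqr_ge0.
transitivity (\int[P]_(w in D0) ((s w ^+ 2)%:E + (a ^+ 2)%:E *
    \int[p w]_t (h (w, t) ^+ 2)%:E)).
  apply: eq_integral => w _; rewrite /f /= integral_centered_shift//.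
  exact: (measurableT_comp mh (pair1_measurable (w : FO))).
rewrite ge0_integralD//; last 4 first.
- by move=> w _; rewrite lee_fin sqr_ge0.
- apply/measurable_EFinP; apply: measurable_funTS; apply: measurable_funX.
  exact: (measurableT_comp (mpartial j) (@mid_history j)).
- by move=> w _; rewrite mule_ge0// lee_fin sqr_ge0.
- by apply: measurable_funTS; apply: measurable_funeM.
rewrite IHj ?(ltnW jn)// ge0_integralZl//; last 2 first.
- exact: measurable_funTS.
- by rewrite lee_fin sqr_ge0.
have ja2 : 0 <= (j%:R * a ^+ 2)%:E by rewrite lee_fin mulr_ge0// sqr_ge0.
rewrite -addeA -ge0_muleDl ?lee_fin ?sqr_ge0//.
by rewrite -EFinD -[j.+1]addn1 natrD mulrDl mul1r.
Qed.

End iid_sampling.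

(** * Euclidean norm and descent inequality *)

Section euclidean_norm.
Context (R : realType) (d : nat).
Implicit Types x y : 'rV[R]_d.

Lemma rowBE x y i : (x - y) 0 i = x 0 i - y 0 i.
Proof. by rewrite !mxE. Qed.

Lemma enorm_ge0 x : 0 <= enorm x.
Proof. exact: sqrtr_ge0. Qed.

Lemma enorm2E x : enorm x ^+ 2 = \sum_(i < d) x 0 i ^+ 2.
Proof. by rewrite sqr_sqrtr// sumr_ge0// => i _; exact: sqr_ge0. Qed.

Lemma enorm2_gt0 x : x != 0 -> 0 < enorm x ^+ 2.
Proof.
move=> x_neq0; rewrite lt0r sqr_ge0 andbT; apply: contra x_neq0.
rewrite enorm2E psumr_eq0 => [/allP x0|i _]; last exact: sqr_ge0.
apply/eqP/rowP => i; rewrite mxE; apply/eqP.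
by have := x0 i (mem_index_enum _); rewrite sqrf_eq0.
Qed.

Lemma enorm2Z a x : enorm (a *: x) ^+ 2 = a ^+ 2 * enorm x ^+ 2.
Proof.
rewrite !enorm2E mulr_sumr; apply: eq_bigr => i _.
by rewrite mxE exprMn.
Qed.

Lemma enorm2D_le x y : enorm (x + y) ^+ 2 <= 2 * enorm x ^+ 2 + 2 * enorm y ^+ 2.
Proof.
rewrite !enorm2E !mulr_sumr -big_split/= ler_sum// => i _; rewrite mxE.
by have := sqr_ge0 (x 0 i - y 0 i); nra.
Qed.

Definition edot x y : R := \sum_(i < d) x 0 i * y 0 i.

Lemma edotZr a x y : edot x (a *: y) = a * edot x y.
Proof.
by rewrite /edot mulr_sumr; apply: eq_bigr => i _; rewrite mxE mulrCA.
Qed.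

Lemma edotC x y : edot x y = edot y x.
Proof. by apply: eq_bigr => i _; rewrite mulrC. Qed.

Lemma edotBl x y z : edot (x - y) z = edot x z - edot y z.
Proof. by rewrite /edot -sumrB; apply: eq_bigr => i _; rewrite !mxE mulrBl. Qed.

Lemma enorm2_shift c x y :
  enorm (x + c *: y) ^+ 2 = enorm x ^+ 2 + 2 * c * edot x y + c ^+ 2 * enorm y ^+ 2.
Proof.
rewrite !enorm2E /edot !mulr_sumr -!big_split/=.
by apply: eq_bigr => i _; rewrite !mxE; ring.
Qed.

End euclidean_norm.

Section descent.
Context (R : realType) (d : nat) (f : 'rV[R]_d -> R) (L : R).
Hypotheses (L0 : 0 < L) (df : forall x, differentiable (f : _ -> R^o) x)
  (lip : forall x y, enorm (grad f x - grad f y) <= L * enorm (x - y)).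

Lemma derive_grad x h : 'D_h f x = edot (grad f x) h.
Proof.
rewrite (deriveE _ (df x)) [in LHS](row_sum_delta h) linear_sum/=.
apply: eq_bigr => i _; rewrite linearZ/= mxE /partial deriveE; last exact: df.
by rewrite mulrC.
Qed.

Lemma is_derive_along x h (t : R) :
  is_derive t 1 (fun s : R => f (x + s *: h)) (edot (grad f (x + t *: h)) h).
Proof.
have E : (fun k : R => k^-1 *: (f (x + (k *: (1 : R^o) + t) *: h) - f (x + t *: h))) =
    (fun k : R => k^-1 *: (f (k *: h + (x + t *: h)) - f (x + t *: h))).
  apply/funext => k; congr (_ *: (f _ - _)).
  by rewrite /GRing.scale/= mulr1 -/(GRing.scale _ _) scalerDl addrCA.
split.
  rewrite /derivable/=; rewrite E.
  exact: (diff_derivable (df _)).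
by rewrite -derive_grad /derive /= E.
Qed.

(** The function f (x + t h) - t <grad f x, h> + L/2 |h|^2 t^2 of t has a
    nonnegative derivative on the unit interval, hence increases. *)
Lemma descent x h :
  f x + edot (grad f x) h - L / 2 * enorm h ^+ 2 <= f (x + h).
Proof.
pose c := edot (grad f x) h; pose k := L / 2 * enorm h ^+ 2.
pose psi (t : R) : R := f (x + t *: h) - t * c + k * t ^+ 2.
pose dpsi (t : R) : R := edot (grad f (x + t *: h)) h - c + k * (2 * t).
have dpsiE (t : R) : is_derive t 1 psi (dpsi t).
  have ? := is_derive_along x h t.
  rewrite /psi /dpsi; apply: is_derive_eq.
  by rewrite /GRing.scale/=; ring.
have cpsi : {within `[0, 1], continuous psi}.
  apply: derivable_within_continuous => t _.
  by have [] := dpsiE t.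
have [t t01] := MVT ltr01 (fun t _ => dpsiE t) cpsi.
rewrite subr0 mulr1 => psiE.
have t0 : 0 < t by move: t01; rewrite in_itv/= => /andP[].
(* From |a| <= L t |h|, expanding |a + L t h|^2 >= 0 bounds <a, h> from below by
   - L t |h|^2. *)
pose a := grad f (x + t *: h) - grad f x.
have a2 : enorm a ^+ 2 <= (L * t) ^+ 2 * enorm h ^+ 2.
  rewrite -exprMn -[leRHS]real_normK ?num_real//.
  have -> : `|L * t * enorm h| = L * enorm (t *: h).
    rewrite ger0_norm ?mulr_ge0 ?enorm_ge0 ?(ltW L0) ?(ltW t0)// -mulrA.
    congr (_ * _); apply/eqP; rewrite -(@eqrXn2 _ 2) ?mulr_ge0 ?enorm_ge0 ?(ltW t0)//.
    by rewrite enorm2Z exprMn.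
  rewrite lerXn2r ?nnegrE ?mulr_ge0 ?enorm_ge0 ?(ltW L0)//.
  by rewrite (le_trans (lip _ _))// addrAC subrr add0r.
have : 0 <= dpsi t.
  rewrite /dpsi /c -edotBl -/a /k.
  have := sqr_ge0 (enorm (a + (L * t) *: h)); rewrite enorm2_shift => hs.
  have Lt0 : 0 < L * t by exact: mulr_gt0.
  rewrite -(pmulr_rge0 _ Lt0).
  by nra.
rewrite -psiE /psi scale1r scale0r addr0 /c /k expr0n/= expr1n !mulr0 !mul0r !mul1r !mulr1.
by lra.
Qed.

End descent.

(** * Second moments of random vectors *)

Section vector_moments.
Local Open Scope ereal_scope.
Context d0 (T : measurableType d0) (R : realType) (p : probability T R) (d : nat).
Implicit Types X : T -> 'rV[R]_d.

Lemma measurable_enorm2 d1 (O : measurableType d1) (X : O -> 'rV[R]_d) :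
  (forall i, measurable_fun setT (fun t => X t 0%R i)) ->
  measurable_fun setT (fun t => (enorm (X t) ^+ 2)%:E).
Proof.
move=> mX; apply/measurable_EFinP.
rewrite (_ : (fun _ => _) = (fun t => \sum_(i < d) X t 0%R i ^+ 2)%R); last first.
  by apply/funext => t; rewrite enorm2E.
by apply: measurable_sum => i; exact: measurable_funX.
Qed.

Lemma integral_enorm2 d1 (O : measurableType d1) (mu : {measure set O -> \bar R})
    (D : set O) (X : O -> 'rV[R]_d) : measurable D ->
  (forall i, measurable_fun setT (fun t => X t 0%R i)) ->
  \int[mu]_(t in D) (enorm (X t) ^+ 2)%:E =
  \sum_(i < d) \int[mu]_(t in D) (X t 0%R i ^+ 2)%:E.
Proof.
move=> mD mX.
rewrite -ge0_integral_sum//; last 2 first.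
- move=> i; apply/measurable_EFinP/measurable_funTS; exact: measurable_funX.
- by move=> i t _; rewrite lee_fin sqr_ge0.
by apply: eq_integral => t _; rewrite sumEFin enorm2E.
Qed.

Lemma coordinate_moment_lty X i : (forall i, measurable_fun setT (fun t => X t 0%R i)) ->
  \int[p]_t (enorm (X t) ^+ 2)%:E < +oo -> \int[p]_t (X t 0%R i ^+ 2)%:E < +oo.
Proof.
move=> mX; apply: le_lt_trans; apply: ge0_le_integral => //.
- by move=> t _; rewrite lee_fin sqr_ge0.
- by apply/measurable_EFinP; exact: measurable_funX.
- exact: measurable_enorm2.
- move=> t _; rewrite lee_fin enorm2E (bigD1 i)//= lerDl sumr_ge0// => j _.
  exact: sqr_ge0.
Qed.

Lemma centered_mean (X : T -> R) mu : measurable_fun setT X ->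
  \int[p]_t (X t ^+ 2)%:E < +oo -> \int[p]_t (X t)%:E = mu%:E ->
  \int[p]_t (X t - mu)%:E = 0.
Proof.
move=> mX X2 EX; have iX := integrable_square_integrable mX X2.
under eq_integral do rewrite EFinB.
rewrite integralB//; last exact: finite_measure_integrable_cst.
by rewrite integral_cst// [X in _ * X]probability_setT mule1 EX subee.
Qed.

Lemma centered_second_moment (X : T -> R) mu : measurable_fun setT X ->
  \int[p]_t (X t ^+ 2)%:E < +oo -> \int[p]_t (X t)%:E = mu%:E ->
  (mu ^+ 2)%:E + \int[p]_t ((X t - mu) ^+ 2)%:E = \int[p]_t (X t ^+ 2)%:E.
Proof.
move=> mX X2 EX.
have mXmu : measurable_fun setT (fun t => X t - mu)%R by exact: measurable_funB.
have fin : \int[p]_t ((X t - mu) ^+ 2)%:E < +oo.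
  apply: (@le_lt_trans _ _ (\int[p]_t ((2 * mu ^+ 2)%:E + 2%:E * (X t ^+ 2)%:E))).
    apply: ge0_le_integral => //.
    - by move=> t _; rewrite lee_fin sqr_ge0.
    - by apply/measurable_EFinP; exact: measurable_funX.
    - apply: emeasurable_funD => //; apply: measurable_funeM.
      by apply/measurable_EFinP; exact: measurable_funX.
    - move=> t _; rewrite -EFinM -EFinD lee_fin.
      by have := sqr_ge0 (X t + mu)%R; nra.
  rewrite ge0_integralD//; last 3 first.
  - by move=> t _; rewrite lee_fin mulr_ge0// sqr_ge0.
  - by move=> t _; rewrite -EFinM lee_fin mulr_ge0// sqr_ge0.
  - apply: measurable_funeM.
    by apply/measurable_EFinP; exact: measurable_funX.
  rewrite integral_cst// [X in _ * X]probability_setT mule1 lte_add_pinfty ?ltry//.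
  rewrite ge0_integralZl//; last 2 first.
  - by apply/measurable_EFinP; exact: measurable_funX.
  - by move=> t _; rewrite lee_fin sqr_ge0.
  by rewrite lte_mul_pinfty// lee_fin.
have := integral_centered_shift mu 1 mXmu fin (centered_mean mX X2 EX).
rewrite expr1n mul1e => <-.
by apply: eq_integral => t _; congr (_ ^+ 2)%:E; ring.
Qed.

Lemma vector_centered_second_moment X (mu : 'rV[R]_d) :
  (forall i, measurable_fun setT (fun t => X t 0%R i)) ->
  \int[p]_t (enorm (X t) ^+ 2)%:E < +oo ->
  (forall i, \int[p]_t (X t 0%R i)%:E = (mu 0%R i)%:E) ->
  (enorm mu ^+ 2)%:E + \int[p]_t (enorm (X t - mu) ^+ 2)%:E =
  \int[p]_t (enorm (X t) ^+ 2)%:E.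
Proof.
move=> mX X2 EX.
rewrite !integral_enorm2//; last first.
  move=> i; rewrite (_ : (fun _ => _) = (fun t => X t 0%R i - mu 0%R i)%R).
    exact: measurable_funB.
  by apply/funext => t; rewrite !mxE.
rewrite enorm2E -sumEFin -big_split/=; apply: eq_bigr => i _.
rewrite -(@centered_second_moment (fun t => X t 0%R i) (mu 0%R i))//; last first.
  exact: coordinate_moment_lty.
by congr (_ + _); apply: eq_integral => t _; rewrite !mxE.
Qed.

End vector_moments.

(** * Moments of the trajectory gradients *)

Section policy_gradient.
Context (R : realType) dS dA (S : measurableType dS) (A : measurableType dA)
  (d : nat) (M : mdp R S A) (pi : policy R S A d)
  (g : traj M -> 'rV[R]_d -> 'rV[R]_d) (sigma L L_g Gam alpha_w : R).
Hypotheses (hg : measurable_gradient g) (hA1 : unbiased_gradient pi g)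
  (hA3 : bounded_variance pi g sigma)
  (hconst : smoothness_constants pi g L L_g Gam alpha_w).

Local Notation gradJ := (grad (J M pi)).

Lemma measurable_gradient_comp d0 (O : measurableType d0) (h : O -> traj M)
    (f : O -> 'rV[R]_d) i :
  measurable_fun setT (coords \o f) -> measurable_fun setT h ->
  measurable_fun setT (fun w => g (h w) (f w) 0 i).
Proof.
move=> mf mh.
rewrite (_ : (fun _ => _) = (fun x : d.-tuple R * traj M =>
    g x.2 (row_of x.1) 0 i) \o (fun w => (coords (f w), h w))); last first.
  by apply/funext => w /=; rewrite coordsK.
by apply: measurableT_comp; [exact: hg|exact: measurable_fun_pair].
Qed.

Let measurable_g theta i : measurable_fun setT (fun x : traj M => g x theta 0 i).
Proof. by apply: measurable_gradient_comp => //; exact: measurable_cst. Qed.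

Lemma mean_gradient theta i :
  (\int[traj_law pi theta]_x (g x theta 0 i)%:E = (gradJ theta 0 i)%:E)%E.
Proof. by have [_ /(_ i)] := hA1 theta; rewrite unlock. Qed.

Lemma gradient_variance theta :
  (\int[traj_law pi theta]_x (enorm (g x theta - gradJ theta) ^+ 2)%:E
    <= (sigma ^+ 2)%:E)%E.
Proof. by have := hA3 theta; rewrite unlock. Qed.

Lemma gradient_second_moment theta :
  (\int[traj_law pi theta]_x (enorm (g x theta) ^+ 2)%:E <= Gam%:E)%E.
Proof.
have [_ _ gGam _] := hconst.
apply: (@le_trans _ _ (\int[traj_law pi theta]_x Gam%:E)%E).
  apply: ge0_le_integral => //.
  - by move=> x _; rewrite lee_fin sqr_ge0.
  - exact: measurable_enorm2.
  - by move=> x _; rewrite lee_fin; exact: gGam.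
by rewrite integral_cst// [X in (_ * X)%E]probability_setT mule1.
Qed.

(** A squared mean is at most the second moment. *)
Lemma enorm2_gradJ_le theta : enorm (gradJ theta) ^+ 2 <= Gam.
Proof.
rewrite -lee_fin; apply: le_trans (gradient_second_moment theta).
rewrite -(@vector_centered_second_moment _ _ _ (traj_law pi theta) _
  (fun x => g x theta) (gradJ theta))//.
- by rewrite leeDl// integral_ge0// => x _; rewrite lee_fin sqr_ge0.
- exact: le_lt_trans (gradient_second_moment theta) (ltry _).
- by move=> i; exact: mean_gradient.
Qed.

(** The increment averaged at an inner iteration, theta2 being the current
    parameter and theta1 the previous one. *)
Definition corrected_gradient (x : traj M) theta1 theta2 : 'rV[R]_d :=
  g x theta2 - importance_weight pi x theta2 theta1 *: g x theta1.

Lemma measurable_corrected_gradient d0 (O : measurableType d0) (h : O -> traj M)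
    (f1 f2 : O -> 'rV[R]_d) i :
  measurable_fun setT (coords \o f1) -> measurable_fun setT (coords \o f2) ->
  measurable_fun setT h ->
  measurable_fun setT (fun w => corrected_gradient (h w) (f1 w) (f2 w) 0 i).
Proof.
move=> mf1 mf2 mh.
rewrite (_ : (fun _ => _) = (fun w => g (h w) (f2 w) 0 i -
    importance_weight pi (h w) (f2 w) (f1 w) * g (h w) (f1 w) 0 i)); last first.
  by apply/funext => w; rewrite !mxE.
apply: measurable_funB; first exact: measurable_gradient_comp.
apply: measurable_funM; last exact: measurable_gradient_comp.
exact: measurable_importance_weight.
Qed.

(** The increment is the sum of g(theta2) - g(theta1), controlled by L_g, and of
    (1 - w) g(theta1), controlled by Gam and the second moment of 1 - w. *)
Lemma corrected_gradient_second_moment theta1 theta2 :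
  (\int[traj_law pi theta2]_x (enorm (corrected_gradient x theta1 theta2) ^+ 2)%:E
   <= (2 * (L_g ^+ 2 + Gam * alpha_w) * enorm (theta2 - theta1) ^+ 2)%:E)%E.
Proof.
have [_ gLg gGam wvar] := hconst.
pose D := enorm (theta2 - theta1) ^+ 2.
pose W (x : traj M) := (`|1 - importance_weight pi x theta2 theta1| ^+ 2)%R.
have W0 x : 0 <= W x by exact: sqr_ge0.
have mW : measurable_fun setT W.
  apply: measurable_funX; apply: measurableT_comp => //.
  apply: measurable_funB => //.
  by apply: measurable_importance_weight => //; exact: measurable_cst.
have EW : (\int[traj_law pi theta2]_x (W x)%:E <= (alpha_w * D)%:E)%E.
  by have := wvar theta2 theta1; rewrite unlock.
have Gam0 : 0 <= Gam by exact: le_trans (sqr_ge0 _) (enorm2_gradJ_le 0).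
have D0 : 0 <= D by exact: sqr_ge0.
have bound x : enorm (corrected_gradient x theta1 theta2) ^+ 2 <=
    2 * L_g ^+ 2 * D + 2 * Gam * W x.
  have -> : corrected_gradient x theta1 theta2 = (g x theta2 - g x theta1) +
      (1 - importance_weight pi x theta2 theta1) *: g x theta1.
    by apply/rowP => i; rewrite !mxE; ring.
  apply: le_trans (enorm2D_le _ _) _.
  rewrite -(mulrA 2 (L_g ^+ 2)) -(mulrA 2 Gam); apply: lerD; rewrite ler_pM2l//.
    rewrite /D -exprMn lerXn2r ?nnegrE ?enorm_ge0//.
    exact: le_trans (enorm_ge0 _) (gLg x _ _).
  rewrite enorm2Z mulrC ler_pM ?sqr_ge0//.
  by rewrite /W real_normK// num_real.
apply: (@le_trans _ _ (\int[traj_law pi theta2]_x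
    ((2 * L_g ^+ 2 * D)%:E + (2 * Gam)%:E * (W x)%:E))%E).
  apply: ge0_le_integral => //.
  - by move=> x _; rewrite lee_fin sqr_ge0.
  - apply: measurable_enorm2 => i.
    by apply: measurable_corrected_gradient => //; exact: measurable_cst.
  - apply: emeasurable_funD => //; apply: measurable_funeM.
    exact/measurable_EFinP.
  - by move=> x _; rewrite -EFinM -EFinD lee_fin; exact: bound.
rewrite ge0_integralD//; last 3 first.
- by move=> x _; rewrite lee_fin; apply: mulr_ge0 => //; rewrite mulr_ge0 ?sqr_ge0.
- by move=> x _; rewrite mule_ge0// lee_fin mulr_ge0.
- by apply: measurable_funeM; exact/measurable_EFinP.
rewrite integral_cst// [X in (_ * X)%E]probability_setT mule1 ge0_integralZl//; last 3 first.
- exact/measurable_EFinP.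
- by move=> x _; rewrite lee_fin.
- by rewrite lee_fin mulr_ge0.
apply: (@le_trans _ _ ((2 * L_g ^+ 2 * D)%:E + (2 * Gam)%:E * (alpha_w * D)%:E)%E).
  by rewrite leeD2l// lee_wpmul2l// lee_fin mulr_ge0.
by rewrite -EFinM -EFinD lee_fin le_eqVlt; apply/orP; left; apply/eqP; rewrite -/D; ring.
Qed.

(** The importance weight moves the second mean from the law at theta2 to the law
    at theta1. *)
Lemma mean_corrected_gradient theta1 theta2 i :
  (\int[traj_law pi theta2]_x (corrected_gradient x theta1 theta2 0 i)%:E
   = ((gradJ theta2 - gradJ theta1) 0 i)%:E)%E.
Proof.
pose w (x : traj M) := importance_weight pi x theta2 theta1.
pose X (x : traj M) : R := corrected_gradient x theta1 theta2 0 i.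
have mw : measurable_fun setT w.
  by apply: measurable_importance_weight => //; exact: measurable_cst.
have mX : measurable_fun setT X.
  by apply: measurable_corrected_gradient => //; exact: measurable_cst.
have int2 (Y : traj M -> 'rV[R]_d) :
    (forall i, measurable_fun setT (fun x => Y x 0 i)) ->
    (\int[traj_law pi theta2]_x (enorm (Y x) ^+ 2)%:E < +oo)%E ->
    (traj_law pi theta2).-integrable setT (fun x => (Y x 0 i)%:E).
  move=> mY Y2; apply: integrable_square_integrable => //.
  exact: coordinate_moment_lty.
have iX : (traj_law pi theta2).-integrable setT (EFin \o X).
  apply: (int2 (fun x => corrected_gradient x theta1 theta2)).
    by move=> j; apply: measurable_corrected_gradient => //; exact: measurable_cst.
  exact: le_lt_trans (corrected_gradient_second_moment _ _) (ltry _).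
have ig : (traj_law pi theta2).-integrable setT (fun x => (g x theta2 0 i)%:E).
  apply: (int2 (fun x => g x theta2)) => //.
  exact: le_lt_trans (gradient_second_moment _) (ltry _).
transitivity (\int[traj_law pi theta2]_x
    ((g x theta2 0 i)%:E - (w x * g x theta1 0 i)%:E))%E.
  by apply: eq_integral => x _; rewrite /corrected_gradient !mxE -EFinB.
rewrite integralB//; last first.
  rewrite (_ : (fun _ => _) = (fun x => (g x theta2 0 i)%:E - (X x)%:E)%E).
    exact: integrableB.
  apply/funext => x; rewrite -EFinB /X /corrected_gradient !mxE; congr EFin.
  by rewrite /w; ring.
rewrite (mean_gradient theta2) -(@integral_density_EFin _ _ _ (traj_law pi theta1)
  (traj_law pi theta2) w)//.
- by rewrite (mean_gradient theta1) -EFinB rowBE.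
- by move=> x; exact: importance_weight_ge0.
- by move=> U mU; exact: traj_law_density.
Qed.

End policy_gradient.

(** * Boundedness of the objective and measurability *)

Section bounded_objective.
Context (R : realType) dS dA (S : measurableType dS) (A : measurableType dA)
  (d : nat) (M : mdp R S A) (pi : policy R S A d) (Rmax : R).
Hypothesis reward_le : forall s a, `|reward M (s, a)| <= Rmax.

Lemma traj_return_le (x : traj M) : `|traj_return x| <= (horizon M)%:R * Rmax.
Proof.
have /andP[g0 g1] := discount_range M.
apply: le_trans (ler_norm_sum _ _ _) _.
apply: (@le_trans _ _ (\sum_(t < horizon M) Rmax)); last first.
  by rewrite sumr_const card_ord mulr_natl.
apply: ler_sum => t _; rewrite normrM normrX ger0_norm//.
case: (tnth x t) => s a; rewrite -[leRHS]mul1r ler_pM ?exprn_ge0//.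
by rewrite exprn_ile1// ltW.
Qed.

Lemma measurable_traj_return : measurable_fun setT (@traj_return _ _ _ _ _ M).
Proof.
apply: measurable_sum => t; apply: measurable_funM => //.
exact: measurableT_comp (measurable_reward M) (measurable_tnth t).
Qed.

Lemma J_le theta : `|J M pi theta| <= (horizon M)%:R * Rmax.
Proof.
set K := (horizon M)%:R * Rmax.
have mret := measurable_traj_return.
have le_ret : (\int[traj_law pi theta]_x `|(traj_return (x : traj M))%:E| <= K%:E)%E.
  apply: (@le_trans _ _ (\int[traj_law pi theta]_x K%:E)%E).
    apply: ge0_le_integral => //.
    - by apply: measurableT_comp => //; exact/measurable_EFinP.
    - by move=> x _; rewrite lee_fin; exact: traj_return_le.
  by rewrite integral_cst// [X in (_ * X)%E]probability_setT mule1.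
have := le_abse_integral (traj_law pi theta) measurableT
  (measurableT_comp (@EFin_measurable R setT) mret).
move=> /le_trans /(_ le_ret) le_int.
rewrite /J unlock -lee_fin.
set I := (\int[_]_x _)%E in le_int *.
have fI : I \is a fin_num.
  by rewrite -abse_fin_num ge0_fin_numE// (le_lt_trans le_int)// ltry.
by rewrite -[I]fineK// in le_int.
Qed.

End bounded_objective.

Lemma measurable_fun_random_index d1 d2 (O : measurableType d1)
    (T : measurableType d2) (X : nat -> O -> T) (N : O -> nat) :
  (forall n, measurable_fun setT (X n)) ->
  (forall n, measurable [set w | N w = n]) ->
  measurable_fun setT (fun w => X (N w) w).
Proof.
move=> mX mN _ Y mY; rewrite setTI.
rewrite (_ : _ @^-1` Y = \bigcup_n ([set w | N w = n] `&` (X n @^-1` Y))).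
  apply: bigcupT_measurable => n; apply: measurableI => //.
  by rewrite -[X in measurable X]setTI; exact: mX.
apply/seteqP; split => w /=; first by move=> Yw; exists (N w).
by move=> [n _ [/= <-]].
Qed.

(** Reduces a bound involving a random sample size to one for each fixed size. *)
Lemma le_integral_fibers d1 (O : measurableType d1) (R : realType)
    (mu : {measure set O -> \bar R}) (N : O -> nat) (f h : O -> \bar R) :
  (forall n, measurable [set w | N w = n]) ->
  measurable_fun setT f -> measurable_fun setT h ->
  (forall w, 0 <= f w)%E -> (forall w, 0 <= h w)%E ->
  (forall n, \int[mu]_(w in [set w | N w = n]) f w <=
             \int[mu]_(w in [set w | N w = n]) h w)%E ->
  (\int[mu]_w f w <= \int[mu]_w h w)%E.
Proof.
move=> mN mf mh f0 h0 fh.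
have NT : setT = \bigcup_n [set w | N w = n].
  by apply/seteqP; split => // w _; exists (N w).
have tN : trivIset setT (fun n => [set w | N w = n]).
  by apply/trivIsetP => i j _ _ /eqP ij; apply/seteqP; split => // w [/= -> /ij].
rewrite NT !ge0_integral_bigcup// -?NT//.
by apply: lee_nneseries => // n _ _; exact: integral_ge0.
Qed.

Section rounding.
Context (R : realType).
Implicit Types x : R.

Lemma natr_nat_ceil x : 0 <= x -> (nat_ceil x)%:R = (Num.ceil x)%:~R :> R.
Proof.
move=> x0; rewrite /nat_ceil -[LHS]/((`|Num.ceil x|%N : int)%:~R) gez0_abs//.
by rewrite ceil_ge0 (lt_le_trans _ x0).
Qed.

Lemma nat_ceil_ge x : 0 <= x -> x <= (nat_ceil x)%:R.
Proof. by move=> x0; rewrite natr_nat_ceil// ceil_ge. Qed.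

Lemma nat_ceil_gt0 x : 0 < x -> (0 < nat_ceil x)%N.
Proof.
by move=> x0; rewrite -(ltr_nat R) (lt_le_trans x0)// nat_ceil_ge// ltW.
Qed.

Lemma nat_ceil_lt x : 0 <= x -> (nat_ceil x)%:R < x + 1.
Proof.
by move=> x0; rewrite natr_nat_ceil// -ltrBlDr; have := ceilB1_lt x; rewrite rmorphB.
Qed.

(** An epoch of rounded length has at most x inner iterations. *)
Lemma pred_nat_ceil_le x : 0 < x -> (nat_ceil x).-1%:R <= x.
Proof.
move=> x0; have := nat_ceil_lt (ltW x0).
by rewrite -{1}(prednK (nat_ceil_gt0 x0)) -natr1 ltrD2r => /ltW.
Qed.

End rounding.

(** Since nat_ceil is the absolute value of the ceiling, each fiber consists of
    two fibers of the ceiling, which are preimages of half-open intervals. *)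
Lemma measurable_nat_ceil d1 (O : measurableType d1) (R : realType) (X : O -> R) n :
  measurable_fun setT X -> measurable [set w | nat_ceil (X w) = n].
Proof.
move=> mX.
have mceil (z : int) : measurable [set w | Num.ceil (X w) = z].
  rewrite (_ : [set _ | _] = X @^-1` `](z - 1)%:~R, z%:~R]%classic).
    by rewrite -[X in measurable X]setTI; exact: mX.
  by apply/seteqP; split => w /=; rewrite in_itv/= -ceil_eq => /eqP.
rewrite (_ : [set _ | _] = [set w | Num.ceil (X w) = n%:Z] `|`
                           [set w | Num.ceil (X w) = - n%:Z]).
  exact: measurableU.
apply/seteqP; split => w /=; rewrite /nat_ceil.
  by move=> <-; case: (Num.ceil (X w)) => k; [left|right; rewrite NegzE].
by move=> [->|->]; rewrite ?abszN absz_nat.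
Qed.

Section gradient_measurable.
Context (R : realType) dS dA (S : measurableType dS) (A : measurableType dA)
  (d : nat) (M : mdp R S A) (pi : policy R S A d)
  (g : traj M -> 'rV[R]_d -> 'rV[R]_d).
Hypotheses (hg : measurable_gradient g) (hA1 : unbiased_gradient pi g).

(** By unbiasedness and the density of the law at theta with respect to the law at
    0, the gradient is an integral, for a fixed measure, of a jointly measurable
    function. *)
Lemma measurable_gradJ i :
  measurable_fun setT (fun x : d.-tuple R => grad (J M pi) (row_of x) 0 i).
Proof.
pose f (x : d.-tuple R * traj M) : R :=
  importance_weight pi x.2 0 (row_of x.1) * g x.2 (row_of x.1) 0 i.
have mf : measurable_fun setT f.
  apply: measurable_funM; last exact: hg.
  apply: measurable_importance_weight => //.
  - exact: measurable_cst.
  - rewrite (_ : coords \o _ = fst) //.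
    by apply/funext => x /=; apply: eq_from_tnth => j; rewrite tnth_mktuple mxE.
rewrite (_ : (fun _ => _) = fine \o (fun x : d.-tuple R =>
    \int[traj_law pi 0]_t (f (x, t))%:E)%E); last first.
  apply/funext => x /=; rewrite -(@integral_density_EFin _ _ _
    (traj_law pi (row_of x)) _ (fun t => importance_weight pi t 0 (row_of x))).
  - by rewrite (mean_gradient hA1).
  - by apply: measurable_importance_weight => //; exact: measurable_cst.
  - by move=> t; exact: importance_weight_ge0.
  - by move=> U mU; exact: traj_law_density.
  - apply: (@measurable_gradient_comp _ _ _ _ _ _ _ _ hg _ (traj M) id
      (fun=> row_of x) i) => //.
    exact: measurable_cst.
apply: (measurableT_comp (fine_measurable measurableT)).
rewrite (_ : (fun _ => _) = (fun x : d.-tuple R =>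
  fubini_F (traj_law pi 0) ((EFin \o f)^\+)%E x -
  fubini_F (traj_law pi 0) ((EFin \o f)^\-)%E x)%E).
  apply: emeasurable_funB; apply: measurable_fun_fubini_tonelli_F => //.
  - by apply: measurable_funepos; exact/measurable_EFinP.
  - by apply: measurable_funeneg; exact/measurable_EFinP.
apply/funext => x; rewrite /fubini_F [LHS]integralE; congr (_ - _)%E;
  by apply: eq_integral => t _; rewrite ?funeposE ?funenegE.
Qed.

End gradient_measurable.

(** * The run of the algorithm *)

#[local] Opaque J traj_law enorm grad.

Section finite_nonnegative_integrals.
Local Open Scope ereal_scope.
Context d (O : measurableType d) (R : realType) (mu : {measure set O -> \bar R}).

Lemma ge0_integral_lincomb (X Y : O -> R) (a b x y : R) : (0 <= a)%R -> (0 <= b)%R ->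
  measurable_fun setT (EFin \o X) -> measurable_fun setT (EFin \o Y) ->
  (forall w, 0 <= X w)%R -> (forall w, 0 <= Y w)%R ->
  \int[mu]_w (X w)%:E = x%:E -> \int[mu]_w (Y w)%:E = y%:E ->
  \int[mu]_w (a * X w + b * Y w)%:E = (a * x + b * y)%:E.
Proof.
move=> a0 b0 mX mY X0 Y0 EX EY.
rewrite (eq_integral (fun w => a%:E * (X w)%:E + b%:E * (Y w)%:E))//.
rewrite ge0_integralD//; last 4 first.
- by move=> w _; rewrite mule_ge0// lee_fin.
- exact: measurable_funeM.
- by move=> w _; rewrite mule_ge0// lee_fin.
- exact: measurable_funeM.
rewrite !ge0_integralZl//; first by rewrite EX EY -!EFinM -EFinD.
- by move=> w _; rewrite lee_fin.
- by move=> w _; rewrite lee_fin.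
Qed.

Lemma ge0_integral_sum_fin n (X : 'I_n -> O -> R) (x : 'I_n -> R) :
  (forall k, measurable_fun setT (EFin \o X k)) -> (forall k w, 0 <= X k w)%R ->
  (forall k, \int[mu]_w (X k w)%:E = (x k)%:E) ->
  \int[mu]_w (\sum_(k < n) X k w)%R%:E = (\sum_(k < n) x k)%R%:E.
Proof.
move=> mX X0 EX; rewrite -sumEFin.
rewrite (eq_integral (fun w => \sum_(k < n) (X k w)%:E)); last first.
  by move=> w _; rewrite sumEFin.
rewrite ge0_integral_sum//; first by apply: eq_bigr => k _; exact: EX.
by move=> k w _; rewrite lee_fin.
Qed.

End finite_nonnegative_integrals.

Section run.
Context (R : realType) dS dA (S : measurableType dS) (A : measurableType dA)
  (d : nat) (M : mdp R S A) (pi : policy R S A d)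
  (g : traj M -> 'rV[R]_d -> 'rV[R]_d) (theta0 : 'rV[R]_d)
  (sigma L L_g Gam alpha_w eta eps alpha beta : R) (m B K : nat)
  dO (O : measurableType dO) (P : probability O R)
  (F : nat -> set (set O)) (tau : nat -> nat -> O -> traj M)
  (theta v : nat -> O -> 'rV[R]_d).
Hypotheses (hg : measurable_gradient g) (hA1 : unbiased_gradient pi g)
  (hA3 : bounded_variance pi g sigma)
  (hconst : smoothness_constants pi g L L_g Gam alpha_w)
  (run : aba_spider_pg pi g theta0 eta eps alpha beta sigma m B K P F tau
    theta v)
  (sigma0 : 0 < sigma) (eps0 : 0 < eps) (alpha0 : 0 < alpha) (beta0 : 0 <= beta)
  (B0 : (0 < B)%N) (Q0 : 0 <= 2 * (L_g ^+ 2 + Gam * alpha_w)).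

Local Notation gradJ := (grad (J M pi)).
Local Notation FO k := (g_sigma_algebraType (F k)).
Local Notation batch k := (fun w => batch_size alpha beta sigma eps m B (v ^~ w) k).

Let sF k : sigma_algebra setT (F k). Proof. exact: (aba_sigma_algebra run). Qed.

Let Fm k : F k `<=` measurable. Proof. exact: (aba_measurable run). Qed.

Let Fid k l : (k <= l)%N -> @measurable_fun _ _ (FO l) (FO k) setT id.
Proof.
move=> kl; apply: (@measurability _ _ (FO l) (FO k) setT id (F k)) => // _ [E FE <-].
rewrite setTI; apply: sub_sigma_algebra; exact: (aba_filtration run kl).
Qed.

Let Oid k : @measurable_fun _ _ O (FO k) setT id.
Proof. exact: measurable_sub_sigma_algebra. Qed.

Let FOE k E : @measurable _ (FO k) E -> F k E.
Proof. by rewrite /measurable/= sigma_algebra_id. Qed.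

Definition adapted k (X : O -> 'rV[R]_d) : Prop :=
  forall i, measurable_fun setT (fun w : FO k => X w 0 i).

Lemma adapted_le k l X : (k <= l)%N -> adapted k X -> adapted l X.
Proof. by move=> kl aX i; exact: (measurableT_comp (aX i) (Fid kl)). Qed.

Lemma adapted_measurable k X : adapted k X ->
  forall i, measurable_fun setT (fun w : O => X w 0 i).
Proof. by move=> aX i; exact: (measurableT_comp (aX i) (@Oid k)). Qed.

Lemma adapted_coords k X : adapted k X ->
  measurable_fun setT (coords \o (X : FO k -> _)).
Proof. by move=> aX; exact: measurable_coords. Qed.

Lemma measurable_sample k i : (k <= K)%N ->
  measurable_fun setT (tau k i : FO k.+1 -> traj M).
Proof.
move=> kK _ U mU; rewrite setTI; apply: sub_sigma_algebra.
exact: (aba_adapted run).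
Qed.

Lemma outer_size_gt0 (u : nat -> 'rV[R]_d) k :
  0 < outer_size alpha beta sigma eps m u k.
Proof.
rewrite /outer_size divr_gt0 ?mulr_gt0 ?exprn_gt0//.
rewrite ltr_wpDl// mulr_ge0 ?divr_ge0// sumr_ge0// => i _; exact: sqr_ge0.
Qed.

Lemma batch_size_gt0 (u : nat -> 'rV[R]_d) k :
  (0 < batch_size alpha beta sigma eps m B u k)%N.
Proof.
rewrite /batch_size; case: ifP => // _.
rewrite -(ltr_nat R); apply: lt_le_trans (outer_size_gt0 u k) _.
exact/nat_ceil_ge/ltW/outer_size_gt0.
Qed.

Lemma batch_size_adapted k n : (forall l, (l < k)%N -> adapted k (v l)) ->
  F k [set w | batch k w = n].
Proof.
move=> av; apply: FOE; rewrite /batch_size.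
case: (k %% m == 0)%N; last first.
  case: (eqVneq B n) => [->|/eqP Bn].
    rewrite (_ : [set _ | _] = setT); first exact: measurableT.
    by apply/seteqP; split.
  rewrite (_ : [set _ | _] = set0); first exact: measurable0.
  by apply/seteqP; split.
apply: (@measurable_nat_ceil _ (FO k)).
rewrite /outer_size; apply: measurable_funM => //.
apply: measurable_fun_inv_ge0.
  apply: measurable_funD => //; apply: measurable_funM => //.
  (* The cutoff l < k restricts the sum to terms that are known to be
     measurable. *)
  rewrite (_ : (fun _ => _) = (fun w => \sum_((k - m)%N <= l < k)
      (if (l < k)%N then enorm (v l w) ^+ 2 else 0))); last first.
    by apply/funext => w; apply: eq_big_nat => l /andP[_ ->].
  apply: measurable_sum => l; case lk: (l < k)%N => //.
  by apply/measurable_EFinP; apply: measurable_enorm2; exact: av.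
move=> w; rewrite addr_ge0 ?(ltW eps0)// mulr_ge0 ?divr_ge0// sumr_ge0// => i _.
exact: sqr_ge0.
Qed.

(** Before iteration k the parameters up to theta_k are known, but the estimates
    only up to v_(k-1). *)
Lemma run_adapted k : (k <= K.+1)%N ->
  (forall l, (l <= k)%N -> adapted k (theta l)) /\
  (forall l, (l < k)%N -> adapted k (v l)).
Proof.
elim: k => [_|k IHk kK].
  split=> // l; rewrite leqn0 => /eqP -> i.
  rewrite (_ : (fun _ => _) = cst (theta0 0 i)); first exact: measurable_cst.
  by apply/funext => w; rewrite (aba_init run).
have [atheta av] := IHk (ltnW kK).
have {}kK : (k <= K)%N by [].
have ctheta l : (l <= k)%N ->
    measurable_fun setT (coords \o (theta l : FO k.+1 -> _)).
  by move=> lk; apply: adapted_coords; exact: adapted_le (leqnSn k) (atheta l lk).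
have msample l : measurable_fun setT (tau k l : FO k.+1 -> traj M).
  exact: measurable_sample.
have avk : adapted k.+1 (v k).
  move=> i; have [mk|mk] := eqVneq (k %% m)%N 0%N.
    pose X n (w : FO k.+1) := n%:R^-1 * \sum_(l < n) g (tau k l w) (theta k w) 0 i.
    rewrite (_ : (fun _ => _) = (fun w => X (batch k w) w)).
      apply: measurable_fun_random_index => n.
        apply: measurable_funM => //; apply: measurable_sum => l.
        by apply: measurable_gradient_comp => //; exact: ctheta.
      apply: sub_sigma_algebra; apply: (aba_filtration run (leqnSn k)).
      exact: batch_size_adapted.
    by apply/funext => w; rewrite (aba_outer run)// mxE summxE.
  case: k => [|k] in kK ctheta mk av msample {IHk atheta} *.
    by rewrite mod0n eqxx in mk.
  rewrite (_ : (fun _ => _) = (fun w => B%:R^-1 * \sum_(l < B)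
      corrected_gradient pi g (tau k.+1 l w) (theta k w) (theta k.+1 w) 0 i +
      v k w 0 i)); last first.
    apply/funext => w; rewrite (aba_inner run)//; last exact/eqP.
    by rewrite !mxE summxE.
  apply: measurable_funD; last exact: (adapted_le (leqnSn _) (av k _)).
  apply: measurable_funM => //; apply: measurable_sum => j.
  by apply: measurable_corrected_gradient => //; exact: ctheta.
split=> l; last first.
  rewrite ltnS leq_eqVlt => /predU1P[->//|lk].
  exact: adapted_le (leqnSn k) (av l lk).
rewrite leq_eqVlt => /predU1P[->|lk]; last exact: adapted_le (leqnSn k) (atheta l lk).
move=> i.
rewrite (_ : (fun _ => _) = (fun w => theta k w 0 i + eta * v k w 0 i)); last first.
  by apply/funext => w; rewrite (aba_update run)// !mxE.
apply: measurable_funD; first exact: (adapted_le (leqnSn k) (atheta k (leqnn k))).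
by apply: measurable_funM => //; exact: avk.
Qed.

Lemma adapted_theta k : (k <= K.+1)%N -> adapted k (theta k).
Proof. by move=> kK; have [+ _] := run_adapted kK; apply. Qed.

Lemma adapted_v k l : (k <= K.+1)%N -> (l < k)%N -> adapted k (v l).
Proof. by move=> kK lk; have [_ +] := run_adapted kK; apply. Qed.

Lemma adapted_gradJ k : (k <= K.+1)%N -> adapted k (fun w => gradJ (theta k w)).
Proof.
move=> kK i.
rewrite (_ : (fun _ => _) = (fun x : d.-tuple R => gradJ (row_of x) 0 i) \o
    (coords \o (theta k : FO k -> _))); last first.
  by apply/funext => w /=; rewrite coordsK.
apply: measurableT_comp; first exact: (measurable_gradJ hg hA1).
by apply: adapted_coords; exact: adapted_theta.
Qed.

Lemma adaptedB k X Y : adapted k X -> adapted k Y -> adapted k (fun w => X w - Y w).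
Proof.
move=> aX aY i; rewrite (_ : (fun _ => _) = (fun w => X w 0 i - Y w 0 i)).
  by apply: measurable_funB; [exact: aX|exact: aY].
by apply/funext => w; rewrite rowBE.
Qed.

(** The law at theta_k relative to a fixed law, in a form that is jointly
    measurable in the outcome and the trajectory. *)
Let density k (x : FO k * traj M) : R := importance_weight pi x.2 0 (theta k x.1).

Let measurable_density k : (k <= K)%N -> measurable_fun setT (@density k).
Proof.
move=> kK; apply: measurable_importance_weight => //; first exact: measurable_cst.
have := adapted_coords (adapted_theta (leqW kK)).
by move=> /measurableT_comp; apply; exact: measurable_fst.
Qed.

Let density_ge0 k x : 0 <= @density k x.
Proof. exact: importance_weight_ge0. Qed.

Let law_density k w U : measurable U -> traj_law pi (theta k w) U =
  (\int[traj_law pi 0]_(x in U) (@density k (w, x))%:E)%E.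
Proof. by move=> mU; exact: traj_law_density. Qed.

Lemma measurable_conditional_integral k (f : FO k * traj M -> \bar R) : (k <= K)%N ->
  measurable_fun setT f -> (forall x, 0 <= f x)%E ->
  measurable_fun setT (fun w : O => \int[traj_law pi (theta k w)]_x f (w, x))%E.
Proof.
move=> kK mf f0.
have mint := measurable_integral_kernel_density (measurable_density kK)
  (@density_ge0 k) (@law_density k) mf f0.
exact: (measurableT_comp mint (@Oid k)).
Qed.

(** The variance computation for the batch of iteration k, coordinate by
    coordinate, on the event that the batch has size n. *)
Lemma step_second_moment k n (c : O -> 'rV[R]_d) (h : O -> traj M -> 'rV[R]_d) a :
  (k <= K)%N -> adapted k c ->
  (forall i, measurable_fun setT (fun x : FO k * traj M => h x.1 x.2 0 i)) ->
  (forall w, \int[traj_law pi (theta k w)]_x (enorm (h w x) ^+ 2)%:E < +oo)%E ->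
  (forall w i, \int[traj_law pi (theta k w)]_x (h w x 0 i)%:E = 0)%E ->
  (\int[P]_(w in [set w | batch k w = n])
    (enorm (c w + a *: \sum_(j < n) h w (tau k j w)) ^+ 2)%:E =
   \int[P]_(w in [set w | batch k w = n]) (enorm (c w) ^+ 2)%:E +
   (n%:R * a ^+ 2)%:E * \int[P]_(w in [set w | batch k w = n])
     \int[traj_law pi (theta k w)]_x (enorm (h w x) ^+ 2)%:E)%E.
Proof.
move=> kK ac mh hfin h0; set D0 := [set w | _].
have FD0 : F k D0.
  by apply: batch_size_adapted => l lk; apply: adapted_v => //; exact: leqW.
have mD0 := Fm FD0.
have mtau i : measurable_fun setT (tau k i).
  exact: (measurableT_comp (measurable_sample i kK) (@Oid k.+1)).
have mhw w i : measurable_fun setT (fun x : traj M => h w x 0 i).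
  exact: (measurableT_comp (mh i) (pair1_measurable (w : FO k))).
have mhtau j i : measurable_fun setT (fun w : O => h w (tau k j w) 0 i).
  exact: (measurableT_comp (mh i) (measurable_fun_pair (@Oid k) (mtau j))).
have mc i : measurable_fun setT (fun w : O => c w 0 i).
  exact: adapted_measurable ac i.
have E i := @second_moment_iid_sum _ O _ (traj M) R P (F k) (tau k)
  (traj_law pi 0) (fun w => traj_law pi (theta k w)) (@density k) D0 n
  (sF k) (@Fm k) mtau (measurable_density kK) (@density_ge0 k)
  (@law_density k) FD0 (fun E U FE ED mU => aba_iid run kK FE ED mU)
  (fun w => c w 0 i) (fun x => h x.1 x.2 0 i) a n (ac i) (mh i).
rewrite integral_enorm2//; last first.
  move=> i; rewrite (_ : (fun _ => _) =
      (fun w => c w 0 i + a * \sum_(j < n) h w (tau k j w) 0 i)).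
    apply: measurable_funD => //; apply: measurable_funM => //.
    exact: measurable_sum.
  by apply/funext => w; rewrite !mxE summxE.
rewrite integral_enorm2//.
transitivity (\sum_(i < d) (\int[P]_(w in D0) (c w 0 i ^+ 2)%:E +
    (n%:R * a ^+ 2)%:E * \int[P]_(w in D0)
      \int[traj_law pi (theta k w)]_x (h w x 0 i ^+ 2)%:E))%E.
  apply: eq_bigr => i _; rewrite -E//.
  - by apply: eq_integral => w _; rewrite !mxE summxE.
  - by move=> w; exact: (@coordinate_moment_lty _ _ _ _ _ (h w) i (mhw w) (hfin w)).
  - by move=> w; exact: h0.
rewrite big_split/=; congr (_ + _)%E.
rewrite -ge0_sume_distrr; last first.
  by move=> i _; do 2 (apply: integral_ge0 => ? _); rewrite lee_fin sqr_ge0.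
congr (_ * _)%E.
rewrite -ge0_integral_sum//; last 2 first.
- move=> i; apply: measurable_funTS.
  apply: (@measurable_conditional_integral k (fun x => (h x.1 x.2 0 i ^+ 2)%:E)) => //.
    by apply/measurable_EFinP; exact: measurable_funX.
  by move=> x; rewrite lee_fin sqr_ge0.
- by move=> i w _; apply: integral_ge0 => x _; rewrite lee_fin sqr_ge0.
by apply: eq_integral => w _; rewrite integral_enorm2.
Qed.

Definition estimation_error k (w : O) : R := enorm (v k w - gradJ (theta k w)) ^+ 2.

Lemma adapted_error k : (k <= K)%N ->
  adapted k.+1 (fun w => v k w - gradJ (theta k w)).
Proof.
move=> kK; apply: adaptedB; first exact: adapted_v.
by apply: adapted_le (leqnSn k) _; apply: adapted_gradJ; exact: leqW.
Qed.

Lemma measurable_error k : (k <= K)%N ->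
  measurable_fun setT (fun w : O => (estimation_error k w)%:E).
Proof.
move=> kK; apply: measurable_enorm2.
exact: adapted_measurable (adapted_error kK).
Qed.

Lemma measurable_enorm2_v k : (k <= K)%N ->
  measurable_fun setT (fun w : O => (enorm (v k w) ^+ 2)%:E).
Proof.
move=> kK; apply: measurable_enorm2.
by apply: (@adapted_measurable k.+1); exact: adapted_v.
Qed.

Lemma measurable_sample_pair k (f1 f2 : O -> 'rV[R]_d) i :
  adapted k f1 -> adapted k f2 ->
  measurable_fun setT (fun x : FO k * traj M =>
    corrected_gradient pi g x.2 (f1 x.1) (f2 x.1) 0 i).
Proof.
move=> a1 a2; apply: measurable_corrected_gradient => //.
- exact: (measurableT_comp (adapted_coords a1) measurable_fst).
- exact: (measurableT_comp (adapted_coords a2) measurable_fst).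
Qed.

(** The new error is the old one plus a mean of B centered samples, so that the
    expected squares add up.  Centering only decreases the second moment, and
    theta_(k+1) - theta_k = eta v_k. *)
Lemma inner_error k : (k < K)%N -> (k.+1 %% m <> 0)%N ->
  (\int[P]_w (estimation_error k.+1 w)%:E <=
   \int[P]_w (estimation_error k w)%:E +
   (2 * (L_g ^+ 2 + Gam * alpha_w) * eta ^+ 2 / B%:R)%:E *
     \int[P]_w (enorm (v k w) ^+ 2)%:E)%E.
Proof.
move=> kK km; set Q := 2 * (L_g ^+ 2 + Gam * alpha_w).
pose mu w := gradJ (theta k.+1 w) - gradJ (theta k w).
pose Y w x := corrected_gradient pi g x (theta k w) (theta k.+1 w).
pose h w x := Y w x - mu w.
pose c w := v k w - gradJ (theta k w).
have atheta1 : adapted k.+1 (theta k.+1) by exact: adapted_theta (leqW _).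
have atheta : adapted k.+1 (theta k).
  by apply: adapted_le (leqnSn k) _; apply: adapted_theta; exact/leqW/ltnW.
have amu : adapted k.+1 mu.
  apply: adaptedB; first exact: adapted_gradJ (leqW _).
  by apply: adapted_le (leqnSn k) _; apply: adapted_gradJ; exact/leqW/ltnW.
have mY i : measurable_fun setT (fun x : FO k.+1 * traj M => Y x.1 x.2 0 i).
  exact: measurable_sample_pair.
have mh i : measurable_fun setT (fun x : FO k.+1 * traj M => h x.1 x.2 0 i).
  rewrite (_ : (fun _ => _) =
      (fun x : FO k.+1 * traj M => Y x.1 x.2 0 i - mu x.1 0 i)); last first.
    by apply/funext => x; rewrite rowBE.
  by apply: measurable_funB => //; exact: (measurableT_comp (amu i) measurable_fst).
have mYw w i : measurable_fun setT (fun x : traj M => Y w x 0 i).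
  exact: (measurableT_comp (mY i) (pair1_measurable (w : FO k.+1))).
have Y2 w := corrected_gradient_second_moment hg hA1 hconst (theta k w) (theta k.+1 w).
have Y2fin w : (\int[traj_law pi (theta k.+1 w)]_x (enorm (Y w x) ^+ 2)%:E < +oo)%E.
  exact: le_lt_trans (Y2 w) (ltry _).
have EY w i : (\int[traj_law pi (theta k.+1 w)]_x (Y w x 0 i)%:E = (mu w 0 i)%:E)%E.
  exact: (mean_corrected_gradient hg hA1 hconst).
have h2 w : (\int[traj_law pi (theta k.+1 w)]_x (enorm (h w x) ^+ 2)%:E <=
    (Q * eta ^+ 2 * enorm (v k w) ^+ 2)%:E)%E.
  apply: (@le_trans _ _ (\int[traj_law pi (theta k.+1 w)]_x (enorm (Y w x) ^+ 2)%:E)%E).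
    have <- := vector_centered_second_moment (mYw w) (Y2fin w) (EY w).
    by rewrite leeDr// lee_fin sqr_ge0.
  rewrite -mulrA -enorm2Z.
  suff -> : eta *: v k w = theta k.+1 w - theta k w by exact: Y2.
  by rewrite (aba_update run) ?(ltnW kK)// addrAC subrr add0r.
have batchT : [set w | batch k.+1 w = B] = setT.
  apply/seteqP; split => // w _ /=; rewrite /batch_size.
  by case: eqP.
have ac : adapted k.+1 c by exact: adapted_error (ltnW kK).
have := @step_second_moment k.+1 B c h B%:R^-1 kK ac mh.
rewrite batchT => E.
have errE w : estimation_error k.+1 w =
    enorm (c w + B%:R^-1 *: \sum_(j < B) h w (tau k.+1 j w)) ^+ 2.
  have vE : v k.+1 w = B%:R^-1 *: \sum_(j < B) Y w (tau k.+1 j w) + v k w.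
    exact: (aba_inner run).
  rewrite /estimation_error vE; congr (enorm _ ^+ 2).
  have -> : \sum_(j < B) h w (tau k.+1 j w) =
      \sum_(j < B) Y w (tau k.+1 j w) - B%:R *: mu w.
    by rewrite big_split/= sumr_const card_ord mulNrn scaler_nat.
  have BV : B%:R^-1 * B%:R = 1 :> R by rewrite mulVf// pnatr_eq0 -lt0n.
  have regroup (s u a b : 'rV[R]_d) : s + u - a = (u - b) + (s - (a - b)).
    by apply/rowP => i; rewrite !mxE; ring.
  rewrite scalerBr scalerA BV scale1r.
  exact: (regroup _ (v k w) (gradJ (theta k.+1 w)) (gradJ (theta k w))).
have lhsE : (\int[P]_w (estimation_error k.+1 w)%:E = \int[P]_w
    (enorm (c w + B%:R^-1 *: \sum_(j < B) h w (tau k.+1 j w)) ^+ 2)%:E)%E.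
  by apply: eq_integral => w _; congr EFin; exact: errE.
have {}E := etrans lhsE (E _ _).
refine (eq_ind_r (fun x => (x <= _)%E) _ (E _ _)); last 2 first.
- by move=> w; exact: le_lt_trans (h2 w) (ltry _).
- move=> w i; rewrite (eq_integral (fun x => (Y w x 0 i - mu w 0 i)%:E)); last first.
    by move=> x _; congr EFin; exact: rowBE.
  apply: centered_mean => //; last exact: EY.
  exact: (@coordinate_moment_lty _ _ _ _ _ (Y w) i (mYw w) (Y2fin w)).
apply: leeD2l; rewrite expr2 mulrA mulfV ?mul1r; last by rewrite pnatr_eq0 -lt0n.
have v2 w : (0 <= (enorm (v k w) ^+ 2)%:E)%E by rewrite lee_fin sqr_ge0.
have mv := measurable_enorm2_v (ltnW kK).
apply: (@le_trans _ _ ((B%:R^-1)%:E *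
    \int[P]_w ((Q * eta ^+ 2)%:E * (enorm (v k w) ^+ 2)%:E))%E).
  rewrite lee_wpmul2l ?lee_fin ?invr_ge0//; apply: ge0_le_integral => //.
  - by move=> w _; apply: integral_ge0 => x _; rewrite lee_fin sqr_ge0.
  - apply: (@measurable_conditional_integral k.+1
      (fun x => (enorm (h x.1 x.2) ^+ 2)%:E)) => //.
      exact: measurable_enorm2.
    by move=> x; rewrite lee_fin sqr_ge0.
  - exact: measurable_funeM.
have Qe0 : (0 <= (Q * eta ^+ 2)%:E)%E by rewrite lee_fin mulr_ge0 ?sqr_ge0.
rewrite ge0_integralZl//.
by rewrite muleA -EFinM (mulrC B%:R^-1).
Qed.

(** Where the batch has size n, the error is the variance of a mean of n samples,
    at most sigma^2 / n; n is at least the unrounded batch size, for which the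
    quotient is the bound. *)
Lemma outer_error k : (k <= K)%N -> (k %% m = 0)%N ->
  (\int[P]_w (estimation_error k w)%:E <=
   (beta / m%:R / alpha)%:E *
     (\sum_((k - m)%N <= i < k) \int[P]_w (enorm (v i w) ^+ 2)%:E) +
   (eps / alpha)%:E)%E.
Proof.
move=> kK km.
have v2 i w : (0 <= (enorm (v i w) ^+ 2)%:E)%E by rewrite lee_fin sqr_ge0.
(* Only the v_l with l < k are known to be measurable, whence the cutoff. *)
pose sq l w : R := if (l < k)%N then enorm (v l w) ^+ 2 else 0.
have sq0 l w : 0 <= sq l w by rewrite /sq; case: ifP => // _; exact: sqr_ge0.
have msq l : measurable_fun setT (fun w : O => (sq l w)%:E).
  rewrite /sq; case lk: (l < k)%N => //.
  by apply: measurable_enorm2_v; rewrite (leq_trans (ltnW lk)).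
pose mass w : R := \sum_((k - m)%N <= l < k) sq l w.
have mass0 w : 0 <= mass w by apply: sumr_ge0.
have massE w : mass w = \sum_((k - m)%N <= l < k) enorm (v l w) ^+ 2.
  by apply: eq_big_nat => l /andP[_ lk]; rewrite /sq lk.
have mmass : measurable_fun setT (fun w : O => mass w).
  by apply: measurable_sum => l; apply/measurable_EFinP; exact: msq.
pose bound w : R := beta / m%:R / alpha * mass w + eps / alpha.
have c0 : 0 <= beta / m%:R / alpha by rewrite !divr_ge0// ltW.
have e0 : 0 <= eps / alpha by rewrite divr_ge0// ltW.
have bound0 w : 0 <= bound w by rewrite addr_ge0// mulr_ge0.
have mbound : measurable_fun setT (fun w : O => (bound w)%:E).
  by apply/measurable_EFinP; apply: measurable_funD => //; exact: measurable_funM.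
have boundE w : bound w = sigma ^+ 2 / outer_size alpha beta sigma eps m (v ^~ w) k.
  have s0 : sigma != 0 by rewrite gt_eqF.
  have a0 : alpha != 0 by rewrite gt_eqF.
  have X0 : beta / m%:R * mass w + eps != 0.
    by rewrite gt_eqF// ltr_wpDl// mulr_ge0// divr_ge0.
  rewrite /outer_size -massE /bound.
  move: (beta / m%:R) (mass w) X0 => b x X0.
  by field; rewrite s0 a0 X0.
apply: (@le_trans _ _ (\int[P]_w (bound w)%:E)%E); last first.
  rewrite /bound; under eq_integral do rewrite EFinD EFinM.
  have mmassE : measurable_fun setT (fun w : O => (mass w)%:E) by exact/measurable_EFinP.
  rewrite ge0_integralD//; last 2 first.
  - by move=> w _; rewrite -EFinM lee_fin mulr_ge0.
  - exact: measurable_funeM.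
  rewrite integral_cst// [X in (_ * X)%E]probability_setT mule1.
  rewrite ge0_integralZl//; last by move=> w _; rewrite lee_fin.
  rewrite (_ : (\int[P]_w (mass w)%:E =
    \sum_((k - m)%N <= i < k) \int[P]_w (enorm (v i w) ^+ 2)%:E)%E)//.
  transitivity (\sum_((k - m)%N <= i < k) \int[P]_w (sq i w)%:E)%E.
    rewrite -ge0_integral_sum//; first by apply: eq_integral => w _; rewrite sumEFin.
    by move=> l w _; rewrite lee_fin.
  by apply: eq_big_nat => l /andP[_ lk]; rewrite /sq lk.
have mN n : measurable [set w | batch k w = n].
  by apply: Fm; apply: batch_size_adapted => l lk; apply: adapted_v => //; exact: leqW.
apply: (@le_integral_fibers _ _ _ P (batch k)) => //.
- exact: measurable_error.
- by move=> w; rewrite lee_fin; exact: sqr_ge0.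
case=> [|n].
  rewrite (_ : [set w | batch k w = 0%N] = set0) ?integral_set0//.
  by apply/seteqP; split => // w /= Nw; have := batch_size_gt0 (v ^~ w) k; rewrite Nw.
pose h w x := g x (theta k w) - gradJ (theta k w).
have atheta : adapted k (theta k) by exact: adapted_theta (leqW _).
have agrad : adapted k (fun w => gradJ (theta k w)) by exact: adapted_gradJ (leqW _).
have mg i : measurable_fun setT (fun x : FO k * traj M => g x.2 (theta k x.1) 0 i).
  apply: measurable_gradient_comp => //.
  exact: (measurableT_comp (adapted_coords atheta) measurable_fst).
have mh i : measurable_fun setT (fun x : FO k * traj M => h x.1 x.2 0 i).
  rewrite (_ : (fun _ => _) =
      (fun x : FO k * traj M =>
        g x.2 (theta k x.1) 0 i - gradJ (theta k x.1) 0 i)); last first.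
    by apply/funext => x; rewrite rowBE.
  by apply: measurable_funB => //; exact: (measurableT_comp (agrad i) measurable_fst).
have h2 w : (\int[traj_law pi (theta k w)]_x (enorm (h w x) ^+ 2)%:E <=
    (sigma ^+ 2)%:E)%E.
  exact: gradient_variance.
have h0 w i : (\int[traj_law pi (theta k w)]_x (h w x 0 i)%:E = 0)%E.
  rewrite (eq_integral (fun x =>
    (g x (theta k w) 0 i - gradJ (theta k w) 0 i)%:E)); last first.
    by move=> x _; congr EFin; exact: rowBE.
  have mgw j : measurable_fun setT (fun x : traj M => g x (theta k w) 0 j).
    exact: (measurableT_comp (mg j) (pair1_measurable (w : FO k))).
  apply: centered_mean => //; last exact: mean_gradient.
  apply: (@coordinate_moment_lty _ _ _ _ _ (fun x => g x (theta k w)) i mgw).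
  exact: le_lt_trans (gradient_second_moment hg hconst _) (ltry _).
have ac : adapted k (fun=> 0 : 'rV[R]_d) by move=> i; exact: measurable_cst.
have E := @step_second_moment k n.+1 (fun=> 0) h n.+1%:R^-1 kK ac mh
  (fun w => le_lt_trans (h2 w) (ltry _)) h0.
have nV : n.+1%:R^-1 * n.+1%:R = 1 :> R by rewrite mulVf// pnatr_eq0.
have lhsE : (\int[P]_(w in [set w | batch k w = n.+1]) (estimation_error k w)%:E =
    \int[P]_(w in [set w | batch k w = n.+1])
      (enorm (0 + n.+1%:R^-1 *: \sum_(j < n.+1) h w (tau k j w)) ^+ 2)%:E)%E.
  apply: eq_integral => w; rewrite inE /= => Nw; congr EFin.
  have -> : \sum_(j < n.+1) h w (tau k j w) =
      \sum_(j < n.+1) g (tau k j w) (theta k w) - n.+1%:R *: gradJ (theta k w).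
    by rewrite big_split/= sumr_const card_ord mulNrn scaler_nat.
  rewrite add0r scalerBr scalerA nV scale1r /estimation_error.
  by rewrite (aba_outer run)//= Nw.
refine (eq_ind_r (fun x => (x <= _)%E) _ (etrans lhsE E)).
have enorm20 : enorm (0 : 'rV[R]_d) ^+ 2 = 0.
  by rewrite enorm2E big1// => i _; rewrite mxE expr0n.
rewrite enorm20 integral0 add0e expr2 mulrA mulfV ?mul1r ?pnatr_eq0//.
apply: (@le_trans _ _ ((n.+1%:R^-1)%:E *
    \int[P]_(w in [set w | batch k w = n.+1]) (sigma ^+ 2)%:E)%E).
  rewrite lee_wpmul2l ?lee_fin ?invr_ge0//; apply: ge0_le_integral => //.
  - by move=> w _; apply: integral_ge0 => x _; rewrite lee_fin sqr_ge0.
  - apply: measurable_funTS; apply: (@measurable_conditional_integral k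
      (fun x => (enorm (h x.1 x.2) ^+ 2)%:E)) => //.
      exact: measurable_enorm2.
    by move=> x; rewrite lee_fin sqr_ge0.
rewrite -ge0_integralZl//; last by move=> w _; rewrite lee_fin sqr_ge0.
apply: ge0_le_integral => //.
- by move=> w _; rewrite mule_ge0 ?lee_fin ?invr_ge0 ?sqr_ge0.
- exact: measurable_funTS.
move=> w /= Nw; rewrite lee_fin boundE mulrC ler_pM2l ?exprn_gt0//.
rewrite lef_pV2 ?posrE ?outer_size_gt0//.
have := nat_ceil_ge (ltW (outer_size_gt0 (v ^~ w) k)).
by move: Nw; rewrite /batch_size km eqxx => ->.
Qed.

Lemma measurable_enorm2_gradJ k : (k <= K)%N ->
  measurable_fun setT (fun w : O => (enorm (gradJ (theta k w)) ^+ 2)%:E).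
Proof.
move=> kK; apply: measurable_enorm2.
by apply: (@adapted_measurable k); apply: adapted_gradJ; exact: leqW.
Qed.

Lemma expected_gradJ_le k : (k <= K)%N ->
  (\int[P]_w (enorm (gradJ (theta k w)) ^+ 2)%:E <= Gam%:E)%E.
Proof.
move=> kK; apply: (@le_trans _ _ (\int[P]_w Gam%:E)%E).
  apply: ge0_le_integral => //.
  - by move=> w _; rewrite lee_fin sqr_ge0.
  - exact: measurable_enorm2_gradJ.
  - by move=> w _; rewrite lee_fin; exact: (enorm2_gradJ_le hg hA1 hconst).
by rewrite integral_cst// [X in (_ * X)%E]probability_setT mule1.
Qed.

Lemma expected_v_le k : (k <= K)%N ->
  (\int[P]_w (enorm (v k w) ^+ 2)%:E <=
   2%:E * \int[P]_w (estimation_error k w)%:E + 2%:E * Gam%:E)%E.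
Proof.
move=> kK.
have me := measurable_error kK; have mG := measurable_enorm2_gradJ kK.
have e0 w : (0 <= (estimation_error k w)%:E)%E by rewrite lee_fin sqr_ge0.
have G0 w : (0 <= (enorm (gradJ (theta k w)) ^+ 2)%:E)%E by rewrite lee_fin sqr_ge0.
apply: (@le_trans _ _ (\int[P]_w (2%:E * (estimation_error k w)%:E +
    2%:E * (enorm (gradJ (theta k w)) ^+ 2)%:E))%E).
  apply: ge0_le_integral => //.
  - by move=> w _; rewrite lee_fin sqr_ge0.
  - exact: measurable_enorm2_v.
  - by apply: emeasurable_funD; exact: measurable_funeM.
  - move=> w _; rewrite -!EFinM -EFinD lee_fin.
    by have := enorm2D_le (v k w - gradJ (theta k w)) (gradJ (theta k w)); rewrite subrK.
rewrite ge0_integralD//; last 4 first.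
- by move=> w _; rewrite mule_ge0.
- exact: measurable_funeM.
- by move=> w _; rewrite mule_ge0.
- exact: measurable_funeM.
rewrite !ge0_integralZl//; apply: leeD2l.
by rewrite lee_wpmul2l//; exact: expected_gradJ_le.
Qed.

(** Needed to compare expectations as real numbers.  No uniform bound is available
    at an inner iteration, because the importance weights may be unbounded;
    finiteness propagates along the recursions for the errors. *)
Lemma moments_finite k : (k <= K)%N ->
  (\int[P]_w (estimation_error k w)%:E < +oo)%E /\
  (\int[P]_w (enorm (v k w) ^+ 2)%:E < +oo)%E.
Proof.
have v_of_e l : (l <= K)%N -> (\int[P]_w (estimation_error l w)%:E < +oo)%E ->
    (\int[P]_w (enorm (v l w) ^+ 2)%:E < +oo)%E.
  move=> lK el; apply: le_lt_trans (expected_v_le lK) _.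
  by rewrite lte_add_pinfty// ?ltry// lte_mul_pinfty.
elim/ltn_ind: k => k IHk kK; suff ek : (\int[P]_w (estimation_error k w)%:E < +oo)%E.
  by split => //; exact: v_of_e.
have [km|/eqP km] := eqVneq (k %% m)%N 0%N.
  apply: le_lt_trans (outer_error kK km) _.
  rewrite lte_add_pinfty// ?ltry// lte_mul_pinfty//.
    by rewrite lee_fin !divr_ge0// ltW.
  rewrite big_nat_cond; apply: lte_sum_pinfty => l /andP[/andP[_ lk] _].
  by have [|_] := IHk l lk; first exact: leq_trans (ltnW lk) kK.
case: k => [|k] in IHk kK km *; first by rewrite mod0n in km.
have [ek uk] := IHk k (ltnSn k) (ltnW kK).
apply: le_lt_trans (inner_error kK km) _.
by rewrite lte_add_pinfty// lte_mul_pinfty// lee_fin divr_ge0// mulr_ge0// sqr_ge0.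
Qed.

(** Polarization writes <grad J, v> as half of |grad J|^2 + |v|^2 - e; for
    eta = 1 / (2L) the quadratic term of the descent inequality consumes half of
    the gain in |v|^2. *)
Lemma descent_step k w : 0 < L -> eta = 1 / (2 * L) -> (k <= K)%N ->
  eta / 4 * enorm (v k w) ^+ 2 + eta / 2 * enorm (gradJ (theta k w)) ^+ 2 <=
  J M pi (theta k.+1 w) - J M pi (theta k w) + eta / 2 * estimation_error k w.
Proof.
move=> L0 etaE kK; have [lip _ _ _] := hconst.
have := descent L0 (fun x => (hA1 x).1) lip (theta k w) (eta *: v k w).
rewrite -(aba_update run w kK) edotZr enorm2Z.
rewrite /estimation_error -[X in v k w + X]scaleN1r enorm2_shift edotC.
have -> : L / 2 * (eta ^+ 2 * enorm (v k w) ^+ 2) = eta / 4 * enorm (v k w) ^+ 2.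
  by rewrite etaE; field; rewrite gt_eqF.
by move=> ?; lra.
Qed.

#[local] Opaque integral estimation_error.

Variable Jmax : R.
Hypotheses (L0 : 0 < L) (etaE : eta = 1 / (2 * L))
  (J_le : forall x, `|J M pi x| <= Jmax).

Definition mean_error k : R := fine (\int[P]_w (estimation_error k w)%:E)%E.
Definition mean_v k : R := fine (\int[P]_w (enorm (v k w) ^+ 2)%:E)%E.
Definition mean_gradJ k : R := fine (\int[P]_w (enorm (gradJ (theta k w)) ^+ 2)%:E)%E.

Lemma mean_errorE k : (k <= K)%N ->
  (\int[P]_w (estimation_error k w)%:E = (mean_error k)%:E)%E.
Proof.
move=> kK; rewrite fineK// ge0_fin_numE; first by have [] := moments_finite kK.
by apply: integral_ge0 => w _; rewrite lee_fin sqr_ge0.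
Qed.

Lemma mean_vE k : (k <= K)%N ->
  (\int[P]_w (enorm (v k w) ^+ 2)%:E = (mean_v k)%:E)%E.
Proof.
move=> kK; rewrite fineK// ge0_fin_numE; first by have [] := moments_finite kK.
by apply: integral_ge0 => w _; rewrite lee_fin sqr_ge0.
Qed.

Lemma mean_gradJE k : (k <= K)%N ->
  (\int[P]_w (enorm (gradJ (theta k w)) ^+ 2)%:E = (mean_gradJ k)%:E)%E.
Proof.
move=> kK; rewrite fineK// ge0_fin_numE; last first.
  by apply: integral_ge0 => w _; rewrite lee_fin sqr_ge0.
by apply: le_lt_trans (ltry Gam); exact: expected_gradJ_le.
Qed.

Lemma mean_v_ge0 k : 0 <= mean_v k.
Proof. by apply: fine_ge0; apply: integral_ge0 => w _; rewrite lee_fin sqr_ge0. Qed.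

Lemma mean_outer_error k : (k < K.+1)%N -> (k %% m = 0)%N ->
  mean_error k <= beta / m%:R / alpha * \sum_((k - m)%N <= i < k) mean_v i + eps / alpha.
Proof.
rewrite ltnS => kK km; rewrite -lee_fin EFinD EFinM -mean_errorE// -sumEFin.
rewrite (eq_big_nat _ _ (F2 := fun i => \int[P]_w (enorm (v i w) ^+ 2)%:E)%E).
  exact: outer_error.
by move=> i /andP[_ ik]; rewrite mean_vE// (leq_trans (ltnW ik)).
Qed.

Lemma mean_inner_error k : (k.+1 < K.+1)%N -> (k.+1 %% m <> 0)%N ->
  mean_error k.+1 <= mean_error k +
    2 * (L_g ^+ 2 + Gam * alpha_w) * eta ^+ 2 / B%:R * mean_v k.
Proof.
rewrite ltnS => kK km; have kK' := ltnW kK.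
have finite_le (x y z : \bar R) (a b c q : R) : (x = a%:E -> y = b%:E ->
    z = c%:E -> x <= y + q%:E * z -> (a <= b + q * c)%R)%E.
  by move=> -> -> ->; rewrite -EFinM -EFinD lee_fin.
exact: (finite_le _ _ _ _ _ _ _ (mean_errorE kK) (mean_errorE kK') (mean_vE kK')
  (inner_error kK km)).
Qed.

(** The differences of J telescope, and J stays between -Jmax and Jmax. *)
Lemma mean_descent :
  \sum_(k < K.+1) (eta / 4 * mean_v k + eta / 2 * mean_gradJ k) <=
  2 * Jmax + eta / 2 * \sum_(k < K.+1) mean_error k.
Proof.
have eta0 : 0 < eta by rewrite etaE divr_gt0// mulr_gt0.
have e40 : 0 <= eta / 4 by rewrite divr_ge0// ltW.
have e20 : 0 <= eta / 2 by rewrite divr_ge0// ltW.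
have Jmax0 : 0 <= Jmax by exact: le_trans (normr_ge0 _) (J_le 0).
have kK (k : 'I_K.+1) : (k <= K)%N by rewrite -ltnS.
have mv (k : 'I_K.+1) : measurable_fun setT (fun w : O => (enorm (v k w) ^+ 2)%:E).
  exact: measurable_enorm2_v.
have mG (k : 'I_K.+1) :
    measurable_fun setT (fun w : O => (enorm (gradJ (theta k w)) ^+ 2)%:E).
  exact: measurable_enorm2_gradJ.
have me (k : 'I_K.+1) :
    measurable_fun setT (fun w : O => (estimation_error k w)%:E).
  exact: measurable_error.
have err0 k w : 0 <= estimation_error k w.
  exact: (sqr_ge0 (enorm (v k w - gradJ (theta k w)))).
pose f k w := eta / 4 * enorm (v k w) ^+ 2 + eta / 2 * enorm (gradJ (theta k w)) ^+ 2.
have f0 k w : 0 <= f k w.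
  by apply: addr_ge0; apply: mulr_ge0 => //; exact: sqr_ge0.
have mf (k : 'I_K.+1) : measurable_fun setT (EFin \o f k).
  apply/measurable_EFinP; apply: measurable_funD.
    by apply: measurable_funM => //; apply/measurable_EFinP; exact: mv.
  by apply: measurable_funM => //; apply/measurable_EFinP; exact: mG.
have Ef (k : 'I_K.+1) : (\int[P]_w (f k w)%:E =
    (eta / 4 * mean_v k + eta / 2 * mean_gradJ k)%:E)%E.
  apply: (ge0_integral_lincomb e40 e20 (mv k) (mG k) _ _
    (mean_vE (kK k)) (mean_gradJE (kK k))) => w; exact: sqr_ge0.
have Eerr := ge0_integral_sum_fin me (fun k w => err0 k w)
  (fun k : 'I_K.+1 => mean_errorE (kK k)).
have E1 : (\int[P]_w (1%R : R)%:E = 1%:E)%E.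
  by rewrite integral_cst// mul1e; exact: probability_setT.
have J20 : 0 <= 2 * Jmax by exact: mulr_ge0.
have mserr : measurable_fun setT
    (EFin \o (fun w : O => \sum_(k < K.+1) estimation_error k w)).
  apply/measurable_EFinP; apply: measurable_sum => k.
  by apply/measurable_EFinP; exact: me.
have serr0 w : 0 <= \sum_(k < K.+1) estimation_error k w.
  exact: sumr_ge0.
have Ebound := ge0_integral_lincomb J20 e20 (@measurable_cst _ _ O _ setT 1%:E)
  mserr (fun=> ler01) serr0 E1 Eerr.
rewrite mulr1 in Ebound.
rewrite -lee_fin -Ebound -(ge0_integral_sum_fin mf (fun k w => f0 k w) Ef).
apply: ge0_le_integral => //.
- by move=> w _; rewrite lee_fin; exact: sumr_ge0.
- apply/measurable_EFinP; apply: measurable_sum => k.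
  by apply/measurable_EFinP; exact: mf.
- apply/measurable_EFinP; apply: measurable_funD => //; apply: measurable_funM => //.
  exact/measurable_EFinP.
move=> w _; rewrite lee_fin.
apply: (@le_trans _ _ (\sum_(k < K.+1) (J M pi (theta k.+1 w) - J M pi (theta k w) +
    eta / 2 * estimation_error k w))).
  by apply: ler_sum => k _; exact: (descent_step w L0 etaE (kK k)).
rewrite big_split/= -mulr_sumr lerD2r.
rewrite -(big_mkord xpredT (fun k => J M pi (theta k.+1 w) - J M pi (theta k w))).
rewrite telescope_sumr//.
have := J_le (theta K.+1 w); have := J_le (theta 0%N w).
by rewrite !ler_norml => /andP[? ?] /andP[? ?]; lra.
Qed.

(** On F K, which contains all the information about theta_0, ..., theta_K, the
    restriction of P to the event xi = k is P divided by K + 1. *)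
Lemma output_mean (xi : O -> 'I_K.+1) : uniform_output P F xi ->
  (\int[P]_w (enorm (gradJ (theta (xi w) w)) ^+ 2)%:E =
   (K.+1%:R^-1 * \sum_(k < K.+1) mean_gradJ k)%:E)%E.
Proof.
move=> unif.
have kK (k : 'I_K.+1) : (k <= K)%N by rewrite -ltnS.
pose f (k : 'I_K.+1) w : R := enorm (gradJ (theta k w)) ^+ 2.
have f0 k w : 0 <= f k w by exact: sqr_ge0.
have mxi k : measurable (xi @^-1` [set k]) by have [] := unif k.
have mfK (k : 'I_K.+1) :
    measurable_fun setT (fun w : g_sigma_algebraType (F K) => (f k w)%:E).
  apply: measurable_enorm2.
  by apply: (adapted_le (kK k)); apply: adapted_gradJ; exact: leqW.
have mf (k : 'I_K.+1) : measurable_fun setT (fun w : O => (f k w)%:E).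
  exact: (measurableT_comp (mfK k) (measurable_sub_sigma_algebra (@Fm K))).
pose X (k : 'I_K.+1) w : R := \1_(xi @^-1` [set k]) w * f k w.
have mX k : measurable_fun setT (EFin \o X k).
  apply/measurable_EFinP; apply: measurable_funM; first exact: measurable_indic.
  by apply/measurable_EFinP; exact: mf.
have EX k : (\int[P]_w (X k w)%:E = (K.+1%:R^-1 * mean_gradJ k)%:E)%E.
  have -> : (\int[P]_w (X k w)%:E = \int[mrestr P (mxi k)]_w (f k w)%:E)%E.
    rewrite integral_mrestr//; last by move=> w; rewrite lee_fin; exact: f0.
    rewrite setTI [RHS]integral_mkcond.
    apply: eq_integral => w _; rewrite patchE /X indicE.
    by case: ifPn => _; rewrite ?mul1r ?mul0r.
  have fE0 w : (0 <= (f k w)%:E)%E by rewrite lee_fin.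
  have V0 : 0 <= K.+1%:R^-1 :> R by rewrite invr_ge0.
  have restrE := @integral_sub_measure _ _ _ _ (mrestr P (mxi k)) (@Fm K) setT
    _ measurableT (mfK k) fE0.
  have PE := @integral_sub_measure _ _ _ _ P (@Fm K) setT _ measurableT (mfK k) fE0.
  have dens (U : set (g_sigma_algebraType (F K))) : measurable U ->
      sub_measure (mrestr P (mxi k)) (@Fm K) U =
      (\int[sub_measure P (@Fm K)]_(w in U) (cst K.+1%:R^-1 w)%:E)%E.
    move=> mU; have [_ unifk] := unif k; apply: esym.
    apply: (etrans (integral_cst _ mU (K.+1%:R^-1)%:E)).
    rewrite muleC; apply/esym/unifk.
    by move: mU; rewrite /measurable/= sigma_algebra_id//; exact: sF.
  have mV : measurable_fun setT (cst (K.+1%:R^-1 : R) : g_sigma_algebraType (F K) -> R).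
    exact: measurable_cst.
  have densE := integral_density mV (fun=> V0) dens (mfK k) fE0.
  apply: (etrans (esym restrE)); apply: (etrans densE).
  rewrite /cst ge0_integralZr//.
  rewrite EFinM muleC; congr (_ * _)%E.
  exact: (etrans PE (mean_gradJE (kK k))).
rewrite mulr_sumr -(ge0_integral_sum_fin mX _ EX); last first.
  by move=> k w; rewrite mulr_ge0.
apply: eq_integral => w _; congr EFin.
rewrite (bigD1 (xi w))//= big1 ?addr0.
  by rewrite /X indicE mem_set// mul1r.
move=> k kxi; rewrite /X indicE memNset ?mul0r// => /= xik.
by rewrite -xik eqxx in kxi.
Qed.

End run.

(** * Summation over epochs *)

Section epochs.
Context (R : realType) (m N : nat) (e u : nat -> R) (b q c : R).
Hypotheses (m0 : (0 < m)%N) (u0 : forall k, 0 <= u k) (b0 : 0 <= b) (q0 : 0 <= q)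
  (outer : forall k, (k < N)%N -> (k %% m = 0)%N ->
    e k <= b * \sum_((k - m)%N <= i < k) u i + c)
  (inner : forall k, (k.+1 < N)%N -> (k.+1 %% m <> 0)%N -> e k.+1 <= e k + q * u k).

Lemma count_window n lo hi : (\sum_(k < n) (lo <= k < hi) <= hi - lo)%N.
Proof.
suff -> : (\sum_(k < n) (lo <= k < hi) = minn n hi - minn n lo)%N by lia.
by elim: n => [|n IHn]; rewrite ?big_ord0 ?big_ord_recr /= ?IHn; lia.
Qed.

(** The recursion is unrolled back to the outer iteration k / m * m that opened
    the current epoch. *)
Let unrolled k : (k < N)%N ->
  e k <= b * \sum_((k %/ m * m - m)%N <= i < k %/ m * m) u i + c +
         q * \sum_(k %/ m * m <= i < k) u i.
Proof.
elim: k => [|k IHk] kN.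
  have := outer kN (mod0n m).
  by rewrite div0n mul0n sub0n !big_geq// !mulr0 addr0.
have [km|/eqP km] := eqVneq (k.+1 %% m)%N 0%N.
  have -> : (k.+1 %/ m * m = k.+1)%N by rewrite [RHS](divn_eq k.+1 m) km addn0.
  by rewrite (big_geq (leqnn _)) mulr0 addr0; exact: outer.
have div_eq : (k.+1 %/ m = k %/ m)%N.
  by rewrite divnS// /dvdn; case: eqP km.
apply: le_trans (inner kN km) _; rewrite div_eq.
rewrite big_nat_recr/=; last by rewrite leq_trunc_div.
by rewrite mulrDr addrA lerD2r IHk// ltnW.
Qed.

(** Double counting: if every index i lies in at most n windows, every u i is
    counted at most n times. *)
Let sum_windows (lo hi : nat -> nat) (n : nat) (a : R) : 0 <= a ->
  (forall k, (k < N)%N -> (hi k <= N)%N) ->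
  (forall i, (\sum_(k < N) (lo k <= i < hi k) <= n)%N) ->
  \sum_(k < N) a * \sum_(lo k <= i < hi k) u i <= n%:R * a * \sum_(i < N) u i.
Proof.
move=> a0 hiN count.
rewrite -mulr_sumr [n%:R * a]mulrC -mulrA ler_wpM2l//.
have -> : \sum_(k < N) \sum_(lo k <= i < hi k) u i =
    \sum_(k < N) \sum_(i < N) (lo k <= i < hi k)%:R * u i.
  apply: eq_bigr => k _.
  rewrite big_geq_mkord.
  rewrite (big_ord_widen_cond N (fun i => (lo k <= i)%N) u (hiN k (ltn_ord k))).
  rewrite big_mkcond; apply: eq_bigr => i _.
  by case: ifP => _; rewrite ?mul1r ?mul0r.
rewrite exchange_big/= mulr_sumr; apply: ler_sum => i _.
rewrite -mulr_suml ler_wpM2r// -natr_sum ler_nat; exact: count.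
Qed.

(** An index i is used by the outer error of the m iterations of the next epoch,
    and by the accumulated inner errors of the later iterations of its own epoch,
    of which there are at most m - 1. *)
Lemma sum_epoch_errors :
  \sum_(k < N) e k <= (m%:R * b + m.-1%:R * q) * \sum_(k < N) u k + N%:R * c.
Proof.
apply: (@le_trans _ _ (\sum_(k < N)
    (b * \sum_((k %/ m * m - m)%N <= i < k %/ m * m) u i + c +
     q * \sum_(k %/ m * m <= i < k) u i))).
  by apply: ler_sum => k _; exact: unrolled.
rewrite !big_split/= sumr_const card_ord -[c *+ N]mulr_natl.
rewrite addrAC lerD2r mulrDl; apply: lerD.
  apply: (@sum_windows (fun k => k %/ m * m - m)%N (fun k => k %/ m * m)%N m b b0).
  - by move=> k kN; apply: leq_trans (leq_trunc_div _ _) (ltnW kN).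
  - move=> i; apply: (@leq_trans ((i %/ m).+2 * m - (i %/ m).+1 * m)).
      apply: leq_trans (count_window N _ _).
      apply: leq_sum => k _; case: (boolP (_ <= i < _)%N) => // /andP[lo hi].
      have h1 : (i %/ m < k %/ m)%N by rewrite ltn_divLR.
      have h2 : ((k %/ m).-1 <= i %/ m)%N by rewrite leq_divRL// -subn1 mulnBl mul1n.
      have kE : (k %/ m = (i %/ m).+1)%N by lia.
      by rewrite -kE leq_trunc_div ltn_ceil.
    by rewrite -mulnBl subSnn mul1n.
apply: (@sum_windows (fun k => k %/ m * m)%N id m.-1 q q0).
- by move=> k kN; exact: ltnW.
- move=> i; apply: (@leq_trans ((i %/ m).+1 * m - i.+1)).
    apply: leq_trans (count_window N _ _).
    apply: leq_sum => k _; case: (boolP (_ <= i < _)%N) => // /andP[lo hi].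
    rewrite hi/=; have : (k %/ m <= i %/ m)%N by rewrite leq_divRL.
    by move=> h; rewrite (leq_trans (ltn_ceil k m0))// leq_mul2r ltnS h orbT.
  by have := leq_trunc_div i m; rewrite mulSn; lia.
Qed.

End epochs.

(** * Complexities *)

Section complexity_bounds.
Context (R : realType) (d : nat) (alpha beta sigma eps : R) (m B K : nat).
Hypotheses (alpha0 : 0 < alpha) (beta0 : 0 < beta) (sigma0 : 0 < sigma)
  (eps0 : 0 < eps) (m0 : (0 < m)%N).
Implicit Types v : nat -> 'rV[R]_d.

Let mass v k : R := beta / m%:R * \sum_((k - m)%N <= i < k) enorm (v i) ^+ 2.

Let coef_gt0 : 0 < beta / m%:R.
Proof. by rewrite divr_gt0// ltr0n. Qed.

Let as_gt0 : 0 < alpha * sigma ^+ 2.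
Proof. by rewrite mulr_gt0// exprn_gt0. Qed.

Let mass_ge0 v k : 0 <= mass v k.
Proof.
apply: mulr_ge0; first exact: ltW.
by apply: sumr_ge0 => i _; exact: sqr_ge0.
Qed.

Let mass_eps_gt0 v k : 0 < mass v k + eps.
Proof. exact: ltr_wpDl. Qed.

Lemma outer_size_le v k :
  outer_size alpha beta sigma eps m v k <= alpha * sigma ^+ 2 / eps.
Proof.
rewrite /outer_size -/(mass v k) ler_pM2l// lef_pV2 ?posrE//.
by rewrite lerDr.
Qed.

(** A nonzero v_i in the preceding epoch makes the denominator exceed eps. *)
Lemma outer_size_lt v k i : (k - m <= i < k)%N -> v i != 0 ->
  outer_size alpha beta sigma eps m v k < alpha * sigma ^+ 2 / eps.
Proof.
move=> ik vi0; rewrite /outer_size -/(mass v k) ltr_pM2l// ltf_pV2 ?posrE//.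
rewrite ltrDr mulr_gt0//.
rewrite (bigD1_seq i)/= ?mem_index_iota// ?iota_uniq//.
apply: ltr_pwDl; first exact: enorm2_gt0.
by apply: sumr_ge0 => j _; exact: sqr_ge0.
Qed.

Lemma aba_complexity_le v :
  aba_complexity alpha beta sigma eps m B K v <= vanilla_complexity alpha sigma eps m B K.
Proof. by rewrite lerD2l; apply: ler_sum => k _; exact: outer_size_le. Qed.

Lemma aba_complexity_lt v i : (i < K %/ m * m)%N -> v i != 0 ->
  aba_complexity alpha beta sigma eps m B K v < vanilla_complexity alpha sigma eps m B K.
Proof.
move=> iK vi0; rewrite /aba_complexity /vanilla_complexity ltrD2l.
pose k := (i %/ m).+1.
have kK : k \in index_iota 0 (K %/ m).+1 by rewrite mem_index_iota /k /= ltnS ltn_divLR.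
rewrite !(bigD1_seq k kK (iota_uniq _ _))/= ltr_leD//.
  apply: (outer_size_lt (i := i)) => //.
  by rewrite /k mulSn addKn leq_trunc_div -mulSn ltn_ceil.
by apply: ler_sum => j _; exact: outer_size_le.
Qed.

End complexity_bounds.

(** In terms of s = sqrt eps, the iterations are O(s^-2), the inner batches
    O(s^-1 + 1), the epochs O(s^-1 + 1) and the outer batches O(s^-2). *)
Lemma vanilla_complexity_bound (R : realType) (sigma L Q Jb : R) :
  0 < sigma -> 0 < L -> 0 < Q -> 0 <= Jb -> exists C : R, forall eps : R, 0 < eps ->
  vanilla_complexity 48 sigma eps (nat_ceil (L * sigma / Num.sqrt (Q * eps)))
     (nat_ceil (sigma * Num.sqrt Q / (L * Num.sqrt eps)))
     (Num.truncn (16 * L * Jb / eps)) <=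
  C * (eps `^ (- (3 / 2)) + eps^-1).
Proof.
move=> sigma0 L0 Q0 Jb0.
pose c1 := 16 * L * Jb; pose c2 := sigma * Num.sqrt Q / L.
pose c3 := c1 * (Num.sqrt Q / (L * sigma)) * (48 * sigma ^+ 2).
exists (2 * c1 * c2 + c3 + 2 * c1 + 48 * sigma ^+ 2) => eps eps0.
pose s := Num.sqrt eps; pose rQ := Num.sqrt Q.
have s0 : 0 < s by rewrite sqrtr_gt0.
have rQ0 : 0 < rQ by rewrite sqrtr_gt0.
have sE : eps = s ^+ 2 by rewrite sqr_sqrtr// ltW.
have powE : eps `^ (- (3 / 2)) = (s ^+ 3)^-1.
  rewrite powRN; congr (_^-1).
  rewrite (_ : 3 / 2 = 2^-1 * 3%:R :> R); last by rewrite mulrC.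
  by rewrite powRrM powR12_sqrt ?ltW// powR_mulrn// ltW.
have c10 : 0 <= c1 by rewrite !mulr_ge0// ltW.
have c20 : 0 < c2 by rewrite divr_gt0// mulr_gt0.
have c30 : 0 <= c3.
  by rewrite !mulr_ge0 ?sqr_ge0// ?invr_ge0 ?mulr_ge0 ?ltW.
pose x := L * sigma / (rQ * s).
have x0 : 0 < x by rewrite divr_gt0// mulr_gt0.
have xE : L * sigma / Num.sqrt (Q * eps) = x by rewrite sqrtrM// ltW.
have yE : sigma * Num.sqrt Q / (L * Num.sqrt eps) = c2 / s.
  by rewrite /c2 -/rQ -/s; field; rewrite !gt_eqF.
rewrite xE yE powE.
set m := nat_ceil _; set B := nat_ceil _; set K := Num.truncn _.
have KE : K%:R <= c1 / s ^+ 2.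
  by rewrite -sE truncn_le divr_ge0// ltW.
have BE : B%:R <= c2 / s + 1 by apply/ltW/nat_ceil_lt/ltW/divr_gt0.
have KmE : (K %/ m)%:R <= c1 * (rQ / (L * sigma)) / s.
  have mx : x <= m%:R by exact/nat_ceil_ge/ltW.
  have : (K %/ m)%:R * x <= c1 / s ^+ 2.
    apply: le_trans KE; apply: (@le_trans _ _ ((K %/ m)%:R * m%:R)).
      by rewrite ler_wpM2l.
    by rewrite -natrM ler_nat leq_trunc_div.
  rewrite -ler_pdivlMr// => /le_trans; apply.
  rewrite le_eqVlt; apply/orP; left; apply/eqP; rewrite /x.
  by field; rewrite !gt_eqF.
rewrite /vanilla_complexity sumr_const_nat subn0 -(mulr_natr (48 * sigma ^+ 2 / eps)).
rewrite -(@natr1 R (K %/ m)) sE.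
apply: (@le_trans _ _ (2 * (c1 / s ^+ 2) * (c2 / s + 1) +
    48 * sigma ^+ 2 / s ^+ 2 * (c1 * (rQ / (L * sigma)) / s + 1))).
  apply: lerD.
    by rewrite -(mulrA 2 K%:R) -(mulrA 2 (c1 / s ^+ 2)) ler_pM2l// ler_pM.
  have q0 : 0 <= 48 * sigma ^+ 2 / s ^+ 2.
    by apply: divr_ge0; [apply: mulr_ge0 => //|]; exact: sqr_ge0.
  by apply: ler_wpM2l => //; rewrite lerD2r.
pose a := s^-1; have a0 : 0 < a by rewrite invr_gt0.
have -> : 2 * (c1 / s ^+ 2) * (c2 / s + 1) +
    48 * sigma ^+ 2 / s ^+ 2 * (c1 * (rQ / (L * sigma)) / s + 1) =
    (2 * c1 * c2 + c3) * a ^+ 3 + (2 * c1 + 48 * sigma ^+ 2) * a ^+ 2.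
  by rewrite /c3 -/rQ /a; field; rewrite !gt_eqF.
rewrite !exprVn -/a.
have -> : (s ^+ 3)^-1 = a ^+ 3 by rewrite exprVn.
have -> : (s ^+ 2)^-1 = a ^+ 2 by rewrite exprVn.
have k1 : 0 <= 2 * c1 * c2 + c3.
  by rewrite addr_ge0// mulr_ge0 ?(ltW c20)// mulr_ge0.
have k2 : 0 <= 2 * c1 + 48 * sigma ^+ 2.
  by apply: addr_ge0; apply: mulr_ge0 => //; exact: sqr_ge0.
have a2 : 0 <= a ^+ 2 by exact: sqr_ge0.
have a3 : 0 <= a ^+ 3 by rewrite exprn_ge0// ltW.
by nra.
Qed.

(** * The theorem *)

(** Without rounding the product is exactly 1/4; rounding B up decreases it, and
    the rounded m minus one is at most the unrounded m. *)
Lemma inner_coefficient_le (R : realType) (sigma L Q eps eta : R) :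
  0 < sigma -> 0 < L -> 0 < Q -> 0 < eps -> eta = 1 / (2 * L) ->
  (nat_ceil (L * sigma / Num.sqrt (Q * eps))).-1%:R *
    (Q * eta ^+ 2 / (nat_ceil (sigma * Num.sqrt Q / (L * Num.sqrt eps)))%:R) <= 1 / 4.
Proof.
move=> sigma0 L0 Q0 eps0 ->.
pose s := Num.sqrt eps; pose r := Num.sqrt Q.
have s0 : 0 < s by rewrite sqrtr_gt0.
have r0 : 0 < r by rewrite sqrtr_gt0.
have QE : Q = r ^+ 2 by rewrite sqr_sqrtr// ltW.
rewrite (sqrtrM _ (ltW Q0)) -/s -/r.
have x0 : 0 < L * sigma / (r * s) by rewrite divr_gt0// mulr_gt0.
have y0 : 0 < sigma * r / (L * s) by rewrite divr_gt0// mulr_gt0.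
have c0 : 0 <= Q * (1 / (2 * L)) ^+ 2 by rewrite mulr_ge0 ?sqr_ge0// ltW.
apply: (@le_trans _ _ (L * sigma / (r * s) *
    (Q * (1 / (2 * L)) ^+ 2 / (sigma * r / (L * s))))).
  apply: ler_pM => //.
  - by rewrite divr_ge0.
  - exact: pred_nat_ceil_le.
  - rewrite ler_wpM2l// lef_pV2 ?posrE ?ltr0n ?nat_ceil_gt0//.
    exact/nat_ceil_ge/ltW.
rewrite QE le_eqVlt; apply/orP; left; apply/eqP.
by field; rewrite !gt_eqF.
Qed.

(** The descent inequality leaves U/2 for the errors, which use at most 3/8 of U.
    The remaining terms are eps/48 per iteration and 8 L Jb, which the number of
    iterations makes at most half of eps per iteration. *)
Lemma mean_gradient_bound (R : realType) (L Jb eps eta U G E kappa : R) (N : nat) :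
  0 < L -> 0 < eps -> eta = 1 / (2 * L) -> 0 <= U -> kappa <= 3 / 8 ->
  eta / 4 * U + eta / 2 * G <= 2 * Jb + eta / 2 * E ->
  E <= kappa * U + N.+1%:R * (eps / 48) ->
  16 * L * Jb / eps < N.+1%:R -> N.+1%:R^-1 * G <= eps.
Proof.
move=> L0 eps0 etaE U0 kappa_le descent errors N_large.
have N0 : 0 < N.+1%:R :> R by rewrite ltr0n.
rewrite ltr_pdivrMr// in N_large.
rewrite mulrC ler_pdivrMr//.
have {}errors : E <= 3 / 8 * U + N.+1%:R * (eps / 48).
  by apply: le_trans errors _; rewrite lerD2r ler_wpM2r.
have {}descent : U / 2 + G <= 8 * L * Jb + E.
  rewrite -(ler_pM2l (_ : 0 < eta / 2)); last first.
    by rewrite etaE !divr_gt0// mulr_gt0.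
  have -> : eta / 2 * (U / 2 + G) = eta / 4 * U + eta / 2 * G by field.
  apply: le_trans descent _; rewrite etaE le_eqVlt; apply/orP; left; apply/eqP.
  by field; rewrite gt_eqF.
by nra.
Qed.

Theorem corollary4 (R : realType) (dS dA : measure_display)
    (S : measurableType dS) (A : measurableType dA) (d : nat)
    (M : mdp R S A) (pi : policy R S A d)
    (g : traj M -> 'rV[R]_d -> 'rV[R]_d) (theta0 : 'rV[R]_d)
    (G C_H Rmax sigma L L_g Gam alpha_w : R)
    (hg : measurable_gradient g)
    (hA1 : unbiased_gradient pi g)
    (hG : 0 <= G) (hC : 0 <= C_H) (hR : 0 <= Rmax)
    (hA2 : regular_policy_and_reward M pi G C_H Rmax)
    (hsigma : 0 < sigma)
    (hA3 : bounded_variance pi g sigma)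
    (hL : 0 < L) (halpha : 0 < alpha_w)
    (hconst : smoothness_constants pi g L L_g Gam alpha_w)
    (Q := 2 * (L_g ^+ 2 + Gam * alpha_w))
    (hQ : 0 < Q)
    (alpha := 48 : R) (beta := 6 : R) (eta := 1 / (2 * L))
    (m := fun eps : R => nat_ceil (L * sigma / Num.sqrt (Q * eps)))
    (B := fun eps : R => nat_ceil (sigma * Num.sqrt Q / (L * Num.sqrt eps))) :
  exists (Keps : R -> nat) (C : R), forall eps : R, 0 < eps ->
    (forall K : nat, (Keps eps <= K)%N ->
     forall (dO : measure_display) (O : measurableType dO) (P : probability O R)
       (F : nat -> set (set O)) (tau : nat -> nat -> O -> traj M)
       (theta v : nat -> O -> 'rV[R]_d) (xi : O -> 'I_K.+1),
     aba_spider_pg pi g theta0 eta eps alpha beta sigma (m eps) (B eps) K P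
       F tau theta v ->
     uniform_output P F xi ->
     ('E_P[fun w => (enorm (grad (J M pi) (theta (xi w) w)) ^+ 2)%R] <= eps%:E)%E
     /\ (forall w : O,
           aba_complexity alpha beta sigma eps (m eps) (B eps) K (v ^~ w)
             <= vanilla_complexity alpha sigma eps (m eps) (B eps) K
           /\ ((exists2 i : nat, (i < K %/ m eps * m eps)%N & v i w != 0) ->
               aba_complexity alpha beta sigma eps (m eps) (B eps) K (v ^~ w)
                 < vanilla_complexity alpha sigma eps (m eps) (B eps) K)))
    /\ vanilla_complexity alpha sigma eps (m eps) (B eps) (Keps eps)
       <= C * (eps `^ (- (3 / 2)) + eps^-1).
Proof.
pose Jb := (horizon M)%:R * Rmax.
have Jb0 : 0 <= Jb by rewrite mulr_ge0.
have reward_le s a : `|reward M (s, a)| <= Rmax by have [] := hA2 s a.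
have J_le := J_le pi reward_le.
have [C boundC] := vanilla_complexity_bound hsigma hL hQ Jb0.
exists (fun eps => Num.truncn (16 * L * Jb / eps)), C => eps eps0.
split; last exact: boundC.
have m0 : (0 < m eps)%N.
  by apply: nat_ceil_gt0; rewrite divr_gt0 ?mulr_gt0// sqrtr_gt0 mulr_gt0.
have B0 : (0 < B eps)%N.
  by apply: nat_ceil_gt0; rewrite divr_gt0 ?mulr_gt0 ?sqrtr_gt0.
have alpha0 : 0 < alpha by rewrite ltr0n.
have beta0 : 0 < beta by rewrite ltr0n.
have Q0 : 0 <= 2 * (L_g ^+ 2 + Gam * alpha_w) by exact: ltW.
move=> K KK dO O P F tau theta v xi run unif; split; last first.
  move=> w; split; first exact: aba_complexity_le.
  by move=> [i iK vi0]; apply: aba_complexity_lt iK vi0.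
rewrite unlock.
have -> := output_mean hg hA1 hconst run eps0 (ltW beta0) unif.
rewrite lee_fin.
pose q := 2 * (L_g ^+ 2 + Gam * alpha_w) * eta ^+ 2 / (B eps)%:R.
have q0 : 0 <= q by rewrite divr_ge0// mulr_ge0// sqr_ge0.
have b0 : 0 <= beta / (m eps)%:R / alpha by rewrite !divr_ge0.
have m_neq0 : (m eps)%:R != 0 :> R by rewrite pnatr_eq0 -lt0n.
(* The outer errors are charged 1/8 of the total, the inner ones at most 1/4. *)
have kappa_le : (m eps)%:R * (beta / (m eps)%:R / alpha) + (m eps).-1%:R * q <= 3 / 8.
  have -> : (m eps)%:R * (beta / (m eps)%:R / alpha) = 1 / 8.
    by rewrite /beta /alpha; field.
  have := inner_coefficient_le hsigma hL hQ eps0 erefl; rewrite -/(m eps) -/(B eps).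
  rewrite -/eta -/q => hq.
  by lra.
have errors := sum_epoch_errors m0 (mean_v_ge0 P v) b0 q0
  (mean_outer_error hg hA1 hA3 hconst run hsigma eps0 alpha0 (ltW beta0) B0 Q0)
  (mean_inner_error hg hA1 hA3 hconst run hsigma eps0 alpha0 (ltW beta0) B0 Q0).
have := mean_descent hg hA1 hA3 hconst run hsigma eps0 alpha0 (ltW beta0) B0 Q0
  hL erefl J_le.
rewrite big_split/= -!mulr_sumr => descent.
have U0 : 0 <= \sum_(k < K.+1) mean_v P v k.
  by apply: sumr_ge0 => k _; exact: mean_v_ge0.
apply: (mean_gradient_bound hL eps0 erefl U0 kappa_le descent errors).
apply: lt_le_trans (truncnS_gt _) _.
by rewrite ler_nat ltnS.
Qed.
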